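(* Let $m,n$ be integers with $\min(m,n)\ge 3$. A non-overlapping $(m,n)$-framework $(p_1,\dots,p_m;\,q_1,\dots,q_n)$ in the Euclidean plane is flexible if and only if one of the following conditions holds. (D1) The points $p_1,\dots,p_m$ lie on a line $P$, the points $q_1,\dots,q_n$ lie on another line $Q$, and these two lines are orthogonal to each other. (D2) One can choose an orthogonal coordinate system and two rectangles with sides parallel to the axes and with common center of symmetry at the origin so that $p_1,\dots,p_m$ are at the vertices of one rectangle and $q_1,\dots,q_n$ are at the vertices of the other one. (Since all points are distinct, in this case $m\le 4$ and $n\le 4$.)
   Context: An $(m,n)$-framework in the Euclidean plane is a collection of points $\mathbf p=(p_1,\dots,p_m;\,q_1,\dots,q_n)$ such that $p_i\ne q_j$ for all $i,j$. The points $p_i,q_j$ are called joints; the two parts are $(p_1,\dots,p_m)$ and $(q_1,\dots,q_n)$; pairs $(p_i,q_j)$ are called rods, and $|p_iq_j|=|p_i-q_j|$ is the rod length. The framework is non-overlapping if all its joints are pairwise distinct. It is flexible if it admits a flex, i.e. a continuous non-constant motion of its joints $\mathbf p(t)=(p_1(t),\dots,q_n(t))$, $t\in[0,1]$, such that $\mathbf p(0)=\mathbf p$, $|p_i(t)-q_j(t)|$ does not depend on $t$ for each $i,j$, and some two joints from different parts do not move. *)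

(* Defs.v *)
From HB Require Import structures.
From mathcomp Require Import all_boot all_order all_algebra.
From mathcomp Require Import all_classical all_reals all_analysis.

Set Implicit Arguments.
Unset Strict Implicit.
Unset Printing Implicit Defensive.

Import Order.TTheory GRing.Theory Num.Theory.
Import numFieldNormedType.Exports.
Local Open Scope classical_set_scope.
Local Open Scope ring_scope.

Notation plane R := (R * R)%type (only parsing).

Definition dotp (R : realType) (u v : plane R) : R := u.1 * v.1 + u.2 * v.2.

(* The library norm on [R * R] is the max norm, hence the explicit Euclidean
   distance below; both norms induce the same topology. *)
Definition eucl_dist (R : realType) (x y : plane R) : R :=
  Num.sqrt (dotp (x - y) (x - y)).

Definition framework (R : realType) (m n : nat)
    (p : 'I_m -> plane R) (q : 'I_n -> plane R) : Prop :=
  forall i j, p i <> q j.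

Definition non_overlapping (R : realType) (m n : nat)
    (p : 'I_m -> plane R) (q : 'I_n -> plane R) : Prop :=
  [/\ injective p, injective q & forall i j, p i <> q j].

(* A motion is a pair of families indexed by time; only its values at times in
   [0, 1] matter. *)
Definition is_flex (R : realType) (m n : nat)
    (p : 'I_m -> plane R) (q : 'I_n -> plane R)
    (pt : R -> 'I_m -> plane R) (qt : R -> 'I_n -> plane R) : Prop :=
  [/\ (forall i, {within `[0, 1], continuous (fun t : R => pt t i)}) /\
      (forall j, {within `[0, 1], continuous (fun t : R => qt t j)}),
      (exists s t : R, [/\ s \in `[0, 1], t \in `[0, 1] &
         (exists i, pt s i <> pt t i) \/ (exists j, qt s j <> qt t j)]),
      (forall i, pt 0 i = p i) /\ (forall j, qt 0 j = q j),
      (forall i j (s t : R), s \in `[0, 1] -> t \in `[0, 1] ->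
         eucl_dist (pt s i) (qt s j) = eucl_dist (pt t i) (qt t j)) &
      (exists i j, forall t : R, t \in `[0, 1] ->
         pt t i = p i /\ qt t j = q j)].

Definition flexible (R : realType) (m n : nat)
    (p : 'I_m -> plane R) (q : 'I_n -> plane R) : Prop :=
  exists pt qt, is_flex p q pt qt.

Definition line (R : realType) (a u : plane R) : set (plane R) :=
  [set x | exists s : R, x = (a.1 + s * u.1, a.2 + s * u.2)].

Definition on_orthogonal_lines (R : realType) (m n : nat)
    (p : 'I_m -> plane R) (q : 'I_n -> plane R) : Prop :=
  exists a u b v : plane R,
    [/\ u <> 0, v <> 0, dotp u v = 0,
        forall i, line a u (p i) & forall j, line b v (q j)].

Definition orthonormal_frame (R : realType) (e1 e2 : plane R) : Prop :=
  [/\ dotp e1 e1 = 1, dotp e2 e2 = 1 & dotp e1 e2 = 0].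

Definition coords (R : realType) (o e1 e2 x : plane R) : plane R :=
  (dotp (x - o) e1, dotp (x - o) e2).

(* [a] and [b] are half the side lengths; to be applied to coordinates. *)
Definition rect_vertices (R : realType) (a b : R) : set (plane R) :=
  [set x | (x.1 = a \/ x.1 = - a) /\ (x.2 = b \/ x.2 = - b)].

Definition on_concentric_rectangles (R : realType) (m n : nat)
    (p : 'I_m -> plane R) (q : 'I_n -> plane R) : Prop :=
  exists o e1 e2 : plane R, orthonormal_frame e1 e2 /\
    exists a b c d : R,
      [/\ [/\ 0 < a, 0 < b, 0 < c & 0 < d],
          forall i, rect_vertices a b (coords o e1 e2 (p i)) &
          forall j, rect_vertices c d (coords o e1 e2 (q j))].

(* Main.v *)
Require Import Defs.
From HB Require Import structures.
From mathcomp Require Import all_boot all_order all_algebra.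
From mathcomp Require Import all_classical all_reals all_analysis.
From mathcomp Require Import ring lra.

(* Necessity. Along a flex the squared distance c between p_0 and p_1 varies.
   Scale the frame centred at the midpoint of p_0 p_1 by 2 sqrt c: the joint
   q_j becomes (d_j, g_j) with d_j constant and g_j^2 a quadratic polynomial
   f_j in c, and p_2 becomes a solution (E, H) of linear equations
   d_j E + g_j H = S + c u_j together with E^2 + H^2 = 2 S + c^2. Eliminating
   E, H, S gives a polynomial relation between c and the square roots g_j,
   valid for infinitely many c. If the f_j are pairwise distinct, the products
   g_i g_j are linearly independent over R(c), and the relation forces the q_j
   to be collinear. Otherwise two joints q_i, q_j form with p_0, p_1 a
   parallelogram, an antiparallelogram or a kite, and comparing coefficients
   yields two concentric rectangles. When the p_i are collinear, Stewart's
   theorem makes them rigid, hence the whole framework, unless the q_j lie on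
   an orthogonal line. "Infinitely many c" is expressed by an ultrafilter of
   times converging to a moment at which the framework starts to move.

   Sufficiency. In suitable axes add k t to the squares of the abscissae and
   subtract it from the squares of the ordinates (for rectangles, of the sums
   and differences of the half sides), then rotate back so that one rod stays
   fixed. *)

Set Implicit Arguments.
Unset Strict Implicit.
Unset Printing Implicit Defensive.

Import Order.TTheory GRing.Theory Num.Theory.
Import numFieldNormedType.Exports.
Local Open Scope classical_set_scope.
Local Open Scope ring_scope.

(** * Polynomial relations between square roots *)

(** A flex is merely continuous, so a square root g_j may change sign along it and no analytic
    continuation is available. The ultrafilter removes this obstacle: of two alternatives that cover
    the times, one holds eventually, so every choice of sign can be made once and for all. As [c]
    tends to [c0] and eventually avoids [c0], a polynomial that vanishes along [c] is zero. The
    scaling by 2 sqrt c clears denominators: d_j becomes the difference of the squared lengths of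
    the rods from q_j to p_0 and p_1, and g_j^2 becomes Heron's polynomial in c. Independence of the
    products g_i g_j is a matter of parity: a square has even multiplicity at every root, whereas
    two different Heron polynomials have a root at which their product vanishes exactly once. The
    passage from three joints in each part to all joints rests on uniqueness: three vertices
    determine the centre of a rectangle and its axes up to exchange. The fixed rod is what
    distinguishes a flex from a rigid motion of the whole framework. *)

Lemma ultra_or (T : Type) (F : set_system T) (A B : T -> Prop) :
  UltraFilter F -> (\forall t \near F, A t \/ B t) ->
  (\forall t \near F, A t) \/ (\forall t \near F, B t).
Proof.
move=> FU AB; have [FA|FnA] := in_ultra_setVsetC A FU; [by left|right].
by apply: filterS2 AB FnA => t [At nAt|//]; case: (nAt At).
Qed.

Lemma cvg_neq (R : realType) (T : Type) (F : set_system T) (f : T -> R)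
    (a b : R) :
  Filter F -> f @ F --> a -> a != b -> \forall t \near F, f t != b.
Proof.
move=> FF fa ab; apply: (fa [set x | x != b]).
exact: (open_nbhs_nbhs (conj (@open_neq R b) ab)).
Qed.

(** Factor [P] as [Q] times a power of X - [c0] with [Q] nonzero at [c0]. Eventually neither factor
    vanishes at [c t]: [Q] by continuity, the power because [c t] differs from [c0]. *)
Lemma poly_near0 (R : realType) (T : Type) (F : set_system T) (c : T -> R)
    (c0 : R) (P : {poly R}) :
  ProperFilter F -> c @ F --> c0 -> (\forall t \near F, c t != c0) ->
  (\forall t \near F, P.[c t] = 0) -> P = 0.
Proof.
move=> FF cc0 cn0 Pc; apply/eqP/negPn/negP => Pn0.
have [k [Q]] := multiplicity_XsubC P c0; rewrite Pn0 /= => Qc0 PE.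
have Qc : (fun t => Q.[c t]) @ F --> Q.[c0].
  by apply: (cvg_comp _ _ cc0); exact: continuous_horner.
have : \forall t \near F, False.
  have Qn := cvg_neq FF Qc Qc0.
  near=> t.
  have : P.[c t] == 0 by apply/eqP; near: t.
  rewrite PE hornerM horner_exp !hornerE mulf_eq0 expf_eq0 subr_eq0.
  have /negPf -> : Q.[c t] != 0 by near: t.
  have /negPf -> : c t != c0 by near: t.
  by rewrite andbF.
by move/filter_const.
Unshelve. all: by end_near. Qed.

Lemma Poly_near0 (R : realType) (T : Type) (F : set_system T) (c : T -> R)
    (c0 : R) (s : seq R) :
  ProperFilter F -> c @ F --> c0 -> (\forall t \near F, c t != c0) ->
  (\forall t \near F, (Poly s).[c t] = 0) -> forall i, s`_i = 0.
Proof.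
move=> FF cc0 cn0 sc i.
by rewrite -coef_Poly (poly_near0 FF cc0 cn0 sc) coef0.
Qed.

(* If q has squared distances x, y to p0, p1 and c is that between p0 and p1,
   this polynomial in c, with s = x + y and d = x - y, is 4 c times the squared
   distance from q to the line p0 p1 (Heron). *)
Definition heightp (R : realType) (s d : R) : {poly R} :=
  - 'X^2 + (2 * s) *: 'X - (d ^+ 2)%:P.

Lemma horner_heightp (R : realType) (s d x : R) :
  (heightp s d).[x] = - x ^+ 2 + 2 * s * x - d ^+ 2.
Proof. by rewrite /heightp !hornerE. Qed.

(** The discriminant is positive, so there are two distinct roots; a quadratic with the same leading
    coefficient that vanished at both would be the same polynomial. *)
Lemma heightp_simple_root (R : realType) (s d s' d' : R) :
  d ^+ 2 < s ^+ 2 -> ~ (s = s' /\ d ^+ 2 = d' ^+ 2) ->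
  exists (x : R) (h : {poly R}),
    [/\ heightp s d = ('X - x%:P) * h, ~~ root h x & ~~ root (heightp s' d') x].
Proof.
move=> ds ne; set r := Num.sqrt (s ^+ 2 - d ^+ 2).
have r2 : r ^+ 2 = s ^+ 2 - d ^+ 2 by rewrite sqr_sqrtr ?subr_ge0 ?ltW.
have r0 : 0 < r by rewrite sqrtr_gt0 subr_gt0.
(* The sign [e] treats the roots [s + r] and [s - r] together. *)
have fE (e : R) : e ^+ 2 = 1 ->
    heightp s d = ('X - (s + e * r)%:P) * - ('X - (s - e * r)%:P).
  move=> e2; rewrite /heightp.
  have dE : d ^+ 2 = (s + e * r) * (s - e * r).
    rewrite (_ : _ * _ = s ^+ 2 - e ^+ 2 * r ^+ 2); last ring.
    by rewrite e2 r2; ring.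
  rewrite dE (_ : 2 * s = (s + e * r) + (s - e * r)); last ring.
  by rewrite -mul_polyC polyCD polyCM; ring.
have hn (e : R) : e ^+ 2 = 1 -> ~~ root (- ('X - (s - e * r)%:P)) (s + e * r).
  move=> e2; rewrite rootN root_XsubC; apply/eqP => h.
  have er : e * r = 0 by lra.
  have : e ^+ 2 * r ^+ 2 = 0 by rewrite -exprMn er expr0n.
  by rewrite e2 mul1r => /eqP; rewrite expf_eq0 /= gt_eqF.
have e1 : (1 : R) ^+ 2 = 1 by ring.
have e2 : (-1 : R) ^+ 2 = 1 by ring.
case: (boolP (root (heightp s' d') (s + 1 * r))) => r1; last first.
  by exists (s + 1 * r), (- ('X - (s - 1 * r)%:P)); split; [exact: fE|exact: hn|].
case: (boolP (root (heightp s' d') (s + -1 * r))) => r3; last first.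
  by exists (s + -1 * r), (- ('X - (s - -1 * r)%:P)); split; [exact: fE|exact: hn|].
exfalso; apply: ne.
move: r1 r3; rewrite /root !horner_heightp => /eqP r1 /eqP r3.
have h : (s' - s) * r = 0 by nra.
have ss : s' = s.
  by move/eqP: h; rewrite mulf_eq0 (gt_eqF r0) orbF subr_eq0 => /eqP.
by split=> //; rewrite ss in r1; nra.
Qed.

(** At the simple root [x] the left side has even multiplicity. The right side has odd multiplicity
    there, unless [Q] is zero. *)
Lemma heightp_indep (R : realType) (s d s' d' : R) (P Q : {poly R}) :
  d ^+ 2 < s ^+ 2 -> ~ (s = s' /\ d ^+ 2 = d' ^+ 2) ->
  P ^+ 2 = Q ^+ 2 * (heightp s d * heightp s' d') -> P = 0 /\ Q = 0.
Proof.
move=> ds ne PQ; have [x [h [hE hx h'x]]] := heightp_simple_root ds ne.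
have Q0 : Q = 0.
  apply/eqP/negPn/negP => Q0.
  have h0 : h != 0 by apply: contraNneq hx => ->; rewrite root0.
  have h'0 : heightp s' d' != 0 by apply: contraNneq h'x => ->; rewrite root0.
  have X0 : 'X - x%:P != 0 by rewrite polyXsubC_eq0.
  have P0 : P != 0.
    apply: contraTneq isT => P0; have := PQ; rewrite P0 expr0n /= => /esym/eqP.
    by rewrite hE expr2 !mulf_eq0 (negPf Q0) (negPf h0) (negPf h'0) (negPf X0).
  have := congr1 (mup x) PQ; rewrite !expr2 hE.
  rewrite mupM // mupM ?mulf_neq0 // mupM // mupMl // mupMl //.
  have -> : mup x ('X - x%:P) = 1%N.
    by have := mup_XsubCX 1 x x; rewrite expr1 eqxx.
  by move/(congr1 odd); rewrite !oddD !addbb.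
split=> //; move: PQ; rewrite Q0 expr0n /= mul0r => /eqP.
by rewrite expf_eq0 /= => /eqP.
Qed.

(** The two equations are the rational part and the g0 g1 part of the square of [P] + [P01] g0 g1 =
    - ([P02] g0 + [P12] g1) g2, where g_i^2 = f_i. *)
Lemma heightp_indep3 (R : realType) (s0 d0 s1 d1 s2 d2 : R)
    (P P01 P02 P12 : {poly R}) :
  let f0 := heightp s0 d0 in let f1 := heightp s1 d1 in
  let f2 := heightp s2 d2 in
  d0 ^+ 2 < s0 ^+ 2 -> d1 ^+ 2 < s1 ^+ 2 ->
  ~ (s0 = s2 /\ d0 ^+ 2 = d2 ^+ 2) -> ~ (s1 = s2 /\ d1 ^+ 2 = d2 ^+ 2) ->
  P ^+ 2 + P01 ^+ 2 * (f0 * f1) = f2 * (P02 ^+ 2 * f0 + P12 ^+ 2 * f1) ->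
  P * P01 = f2 * (P02 * P12) ->
  [/\ P01 = 0, P02 = 0 & P12 = 0].
Proof.
move=> f0 f1 f2 l0 l1 n02 n12 X Y.
have fn0 (s d : R) : heightp s d != 0.
  apply/eqP => /(congr1 (coefp 2)).
  rewrite /coefp /heightp !coefE /= => /eqP; rewrite !mulr0 !subr0 addr0.
  by rewrite oppr_eq0 oner_eq0.
have f0n : f0 != 0 := fn0 _ _.
have f1n : f1 != 0 := fn0 _ _.
(* Multiply the first equation by [P ^+ 2] and replace [P * P01] by means of the second: the
   resulting quadratic equation for [P ^+ 2] splits. *)
have Z : (P ^+ 2 - P02 ^+ 2 * (f0 * f2)) * (P ^+ 2 - P12 ^+ 2 * (f1 * f2)) = 0.
  have -> : (P ^+ 2 - P02 ^+ 2 * (f0 * f2)) * (P ^+ 2 - P12 ^+ 2 * (f1 * f2)) =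
    P ^+ 2 * (P ^+ 2 - f2 * (P02 ^+ 2 * f0 + P12 ^+ 2 * f1)) +
    (f0 * f1) * (f2 * (P02 * P12)) ^+ 2 by ring.
  by rewrite -X -Y; ring.
move/eqP: Z; rewrite mulf_eq0 => /orP[] /eqP/subr0_eq Z.
  have [P0 P020] := heightp_indep l0 n02 Z.
  (* With [P] and [P02] zero, cancelling [f1] and multiplying by [f0] brings the first equation back
     to the case of two polynomials. *)
  have W : (P01 * f0) ^+ 2 = P12 ^+ 2 * (f0 * f2).
    apply: (mulIf f1n).
    move: X; rewrite P0 P020 expr0n /= !mul0r !add0r => X.
    by transitivity (P01 ^+ 2 * (f0 * f1) * f0); [ring|rewrite X; ring].
  have [/eqP W0 ->] := heightp_indep l0 n02 W.
  by move: W0; rewrite mulf_eq0 (negPf f0n) orbF => /eqP ->.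
have [P0 P120] := heightp_indep l1 n12 Z.
have W : (P01 * f1) ^+ 2 = P02 ^+ 2 * (f1 * f2).
  apply: (mulIf f0n).
  move: X; rewrite P0 P120 expr0n /= !mul0r !add0r addr0 => X.
  by transitivity (P01 ^+ 2 * (f0 * f1) * f1); [ring|rewrite X; ring].
have [/eqP W0 ->] := heightp_indep l1 n12 W.
by move: W0; rewrite mulf_eq0 (negPf f1n) orbF => /eqP ->.
Qed.

(* (d, g) and (E, H) are q and p2 in the frame centred at the midpoint of p0 p1
   and scaled by 2 sqrt c; the second equation says that the squared distance
   from q to p2 is (s - u) / 2, where 2 S = E^2 + H^2 - c^2. *)
Definition labelled (R : realType) (c E H S s d u g : R) : Prop :=
  g ^+ 2 = - c ^+ 2 + 2 * s * c - d ^+ 2 /\ E * d + H * g = S + c * u.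

(** Twice the signed area of the triangle with vertices (d_i, g_i), hence zero exactly when they are
    collinear. *)
Definition det3 (R : realType) (d0 g0 d1 g1 d2 g2 : R) : R :=
  (d1 - d0) * (g2 - g0) - (d2 - d0) * (g1 - g0).

(** * Elimination along a flex with three joints q_j *)

Section Heights.
Context (R : realType) (T : Type) (F : set_system T) {FU : UltraFilter F}.
Context (c E H S : T -> R) (c0 : R).
Hypothesis cc0 : c @ F --> c0.
Hypothesis cn0 : \forall t \near F, c t != c0.
Hypothesis base : \forall t \near F,
  [/\ c t != 0, H t != 0 & E t ^+ 2 + H t ^+ 2 = 2 * S t + c t ^+ 2].

(** Coefficient lists allow a relation to be written as an explicit expression in [c t] and its
    coefficients to be read off by computation. *)
Lemma indep1 (s : seq R) :
  (\forall t \near F, horner_rec s (c t) = 0) -> forall i, s`_i = 0.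
Proof.
move=> h; apply: (Poly_near0 _ cc0 cn0).
by apply: filterS h => t; rewrite horner_Poly.
Qed.

(** Multiplication by the conjugate of [P] + [Q] g g' leaves a polynomial identity in [c], to which
    the parity argument applies. *)
Lemma indep2_poly (s d s' d' : R) (g g' : T -> R) (P Q : {poly R}) :
  d ^+ 2 < s ^+ 2 -> ~ (s = s' /\ d ^+ 2 = d' ^+ 2) ->
  (\forall t \near F, g t ^+ 2 = - c t ^+ 2 + 2 * s * c t - d ^+ 2) ->
  (\forall t \near F, g' t ^+ 2 = - c t ^+ 2 + 2 * s' * c t - d' ^+ 2) ->
  (\forall t \near F, P.[c t] + Q.[c t] * (g t * g' t) = 0) ->
  P = 0 /\ Q = 0.
Proof.
move=> ds ne G G' h.
apply: (heightp_indep ds ne); apply/subr0_eq.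
apply: (poly_near0 _ cc0 cn0).
near=> t.
have gt : g t ^+ 2 = - c t ^+ 2 + 2 * s * c t - d ^+ 2 by near: t.
have g't : g' t ^+ 2 = - c t ^+ 2 + 2 * s' * c t - d' ^+ 2 by near: t.
have : P.[c t] + Q.[c t] * (g t * g' t) = 0 by near: t.
move/(congr1 ( *%R (P.[c t] - Q.[c t] * (g t * g' t)))).
rewrite mulr0 => <-.
rewrite !(hornerE, hornerM, horner_exp, horner_heightp) /= -gt -g't; ring.
Unshelve. all: by end_near. Qed.

Lemma indep2 (s d s' d' : R) (g g' : T -> R) (P Q : seq R) :
  d ^+ 2 < s ^+ 2 -> ~ (s = s' /\ d ^+ 2 = d' ^+ 2) ->
  (\forall t \near F, g t ^+ 2 = - c t ^+ 2 + 2 * s * c t - d ^+ 2) ->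
  (\forall t \near F, g' t ^+ 2 = - c t ^+ 2 + 2 * s' * c t - d' ^+ 2) ->
  (\forall t \near F, horner_rec P (c t) + horner_rec Q (c t) * (g t * g' t) = 0) ->
  (forall i, P`_i = 0) /\ (forall i, Q`_i = 0).
Proof.
move=> ds ne G G' h.
have [|P0 Q0] := @indep2_poly s d s' d' g g' (Poly P) (Poly Q) ds ne G G'.
  by apply: filterS h => t; rewrite !horner_Poly.
by split=> i; rewrite -coef_Poly (P0, Q0) coef0.
Qed.

Variables (s0 d0 u0 s1 d1 u1 s2 d2 u2 : R) (g0 g1 g2 : T -> R).
Hypothesis ds0 : d0 ^+ 2 < s0 ^+ 2.
Hypothesis ds1 : d1 ^+ 2 < s1 ^+ 2.
Hypothesis ds2 : d2 ^+ 2 < s2 ^+ 2.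
Hypothesis lab : \forall t \near F,
  [/\ labelled (c t) (E t) (H t) (S t) s0 d0 u0 (g0 t),
      labelled (c t) (E t) (H t) (S t) s1 d1 u1 (g1 t) &
      labelled (c t) (E t) (H t) (S t) s2 d2 u2 (g2 t)].
Hypothesis noncol : \forall t \near F,
  det3 d0 (g0 t) d1 (g1 t) d2 (g2 t) != 0.

(** Isolating the terms with [g2] and squaring leaves a relation in the single product g0 g1, whose
    two parts vanish separately. *)
Lemma heights_indep (P P01 P02 P12 : {poly R}) :
  ~ (s0 = s1 /\ d0 ^+ 2 = d1 ^+ 2) -> ~ (s0 = s2 /\ d0 ^+ 2 = d2 ^+ 2) ->
  ~ (s1 = s2 /\ d1 ^+ 2 = d2 ^+ 2) ->
  (\forall t \near F, P.[c t] + P01.[c t] * (g0 t * g1 t)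
    + P02.[c t] * (g0 t * g2 t) + P12.[c t] * (g1 t * g2 t) = 0) ->
  [/\ P01 = 0, P02 = 0 & P12 = 0].
Proof.
move=> n01 n02 n12 rel.
have [X0 Y0] : P ^+ 2 + P01 ^+ 2 * (heightp s0 d0 * heightp s1 d1)
     - heightp s2 d2 * (P02 ^+ 2 * heightp s0 d0 + P12 ^+ 2 * heightp s1 d1) = 0
   /\ 2%:P * (P * P01 - heightp s2 d2 * (P02 * P12)) = 0.
  apply: (@indep2_poly s0 d0 s1 d1 g0 g1) => //.
  - by apply: filterS lab => t [[]].
  - by apply: filterS lab => t [_ []].
  near=> t.
  have [[G0 _] [G1 _] [G2 _]] : [/\ labelled (c t) (E t) (H t) (S t) s0 d0 u0 (g0 t),
      labelled (c t) (E t) (H t) (S t) s1 d1 u1 (g1 t) &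
      labelled (c t) (E t) (H t) (S t) s2 d2 u2 (g2 t)] by near: t.
  have rt : P.[c t] + P01.[c t] * (g0 t * g1 t)
    + P02.[c t] * (g0 t * g2 t) + P12.[c t] * (g1 t * g2 t) = 0 by near: t.
  rewrite !(horner_heightp, hornerD, hornerN, hornerM, hornerC, horner_exp).
  rewrite -G0 -G1 -G2.
  have {}rt : P.[c t] + P01.[c t] * (g0 t * g1 t)
     = - (P02.[c t] * g0 t + P12.[c t] * g1 t) * g2 t.
    by apply/eqP; rewrite -subr_eq0 -rt; apply/eqP; ring.
  transitivity ((P.[c t] + P01.[c t] * (g0 t * g1 t)) ^+ 2
    - (- (P02.[c t] * g0 t + P12.[c t] * g1 t) * g2 t) ^+ 2); first by ring.
  by rewrite rt subrr.
apply: (@heightp_indep3 _ s0 d0 s1 d1 s2 d2 P P01 P02 P12) => //.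
- exact/subr0_eq.
- apply/subr0_eq/eqP; move/eqP: Y0; rewrite mulf_eq0 polyC_eq0.
  by rewrite pnatr_eq0.
Unshelve. all: by end_near. Qed.

(** Cramer's rule solves the three linear equations for [E], [H], [S] with the determinant [D] of
    the heights as denominator; the quadratic equation then relates [c] to the products of heights.
    The numerator of [H] is [c] times a constant [K], and vanishing coefficients force [K] to
    vanish, against [noncol]. *)
Lemma no_distinct_heights :
  ~ (s0 = s1 /\ d0 ^+ 2 = d1 ^+ 2) -> ~ (s0 = s2 /\ d0 ^+ 2 = d2 ^+ 2) ->
  ~ (s1 = s2 /\ d1 ^+ 2 = d2 ^+ 2) -> False.
Proof.
move=> n01 n02 n12.
(* The minors that occur in Cramer's rule. The three [L] sum to zero, and so do the three [N]. *)
pose L0 := d1 - d2; pose L1 := d2 - d0; pose L2 := d0 - d1.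
pose N0 := u1 - u2; pose N1 := u2 - u0; pose N2 := u0 - u1.
pose M0 := d1 * u2 - u1 * d2; pose M1 := d2 * u0 - u2 * d0.
pose M2 := d0 * u1 - u0 * d1.
pose K := (d1 - d0) * (u2 - u0) - (d2 - d0) * (u1 - u0).
pose P01 : {poly R} := (2 * (N0 * N1 - L0 * L1)) *: 'X + (2 * (M0 * L1 + M1 * L0))%:P.
pose P02 : {poly R} := (2 * (N0 * N2 - L0 * L2)) *: 'X + (2 * (M0 * L2 + M2 * L0))%:P.
pose P12 : {poly R} := (2 * (N1 * N2 - L1 * L2)) *: 'X + (2 * (M1 * L2 + M2 * L1))%:P.
pose P : {poly R} := 'X * ((K ^+ 2)%:P + (N0 ^+ 2 - L0 ^+ 2) *: heightp s0 d0
   + (N1 ^+ 2 - L1 ^+ 2) *: heightp s1 d1 + (N2 ^+ 2 - L2 ^+ 2) *: heightp s2 d2)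
   + (2 * M0 * L0) *: heightp s0 d0 + (2 * M1 * L1) *: heightp s1 d1
   + (2 * M2 * L2) *: heightp s2 d2.
have rel : \forall t \near F, P.[c t] + P01.[c t] * (g0 t * g1 t)
    + P02.[c t] * (g0 t * g2 t) + P12.[c t] * (g1 t * g2 t) = 0.
  near=> t.
  have [ct Ht EH] : [/\ c t != 0, H t != 0 & E t ^+ 2 + H t ^+ 2 = 2 * S t + c t ^+ 2].
    by near: t.
  have [[G0 l0] [G1 l1] [G2 l2]] : [/\ labelled (c t) (E t) (H t) (S t) s0 d0 u0 (g0 t),
      labelled (c t) (E t) (H t) (S t) s1 d1 u1 (g1 t) &
      labelled (c t) (E t) (H t) (S t) s2 d2 u2 (g2 t)] by near: t.
  apply: (mulfI ct); rewrite mulr0.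
  rewrite !(hornerE, hornerM, horner_heightp) /= -G0 -G1 -G2.
  pose D := - (L0 * g0 t + L1 * g1 t + L2 * g2 t).
  have ED : E t * D = - c t * (N0 * g0 t + N1 * g1 t + N2 * g2 t).
    transitivity (- ((E t * d0 + H t * g0 t) * (g2 t - g1 t)
      + (E t * d1 + H t * g1 t) * (g0 t - g2 t)
      + (E t * d2 + H t * g2 t) * (g1 t - g0 t))); first by rewrite /D /L0 /L1 /L2; ring.
    by rewrite l0 l1 l2 /N0 /N1 /N2; ring.
  have HD : H t * D = c t * K.
    transitivity ((d1 - d0) * ((E t * d2 + H t * g2 t) - (E t * d0 + H t * g0 t))
      - (d2 - d0) * ((E t * d1 + H t * g1 t) - (E t * d0 + H t * g0 t))).
      by rewrite /D /L0 /L1 /L2; ring.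
    by rewrite l0 l1 l2 /K; ring.
  have SD : S t * D = c t * (M0 * g0 t + M1 * g1 t + M2 * g2 t).
    have -> : S t * D = (L0 * g0 t + L1 * g1 t + L2 * g2 t) * - S t by rewrite /D; ring.
    have S0 : S t = E t * d0 + H t * g0 t - c t * u0 by rewrite l0; ring.
    have e1 : c t * (u1 - u0) = E t * (d1 - d0) + H t * (g1 t - g0 t).
      have -> : c t * (u1 - u0) = (S t + c t * u1) - (S t + c t * u0) by ring.
      by rewrite -l0 -l1; ring.
    have e2 : c t * (u2 - u0) = E t * (d2 - d0) + H t * (g2 t - g0 t).
      have -> : c t * (u2 - u0) = (S t + c t * u2) - (S t + c t * u0) by ring.
      by rewrite -l0 -l2; ring.
    rewrite S0; transitivity (c t * u0 * (L0 * g0 t + L1 * g1 t + L2 * g2 t)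
       + (c t * (u1 - u0)) * (g2 t * d0 - g0 t * d2)
       + (c t * (u2 - u0)) * (g0 t * d1 - g1 t * d0)).
      by rewrite e1 e2 /L0 /L1 /L2; ring.
    by rewrite /L0 /L1 /L2 /M0 /M1 /M2; ring.
  have : (E t * D) ^+ 2 + (H t * D) ^+ 2 - 2 * (S t * D) * D - (c t * D) ^+ 2 = 0.
    transitivity ((E t ^+ 2 + H t ^+ 2 - 2 * S t - c t ^+ 2) * D ^+ 2); first by ring.
    by rewrite EH; ring.
  by rewrite ED HD SD /D => <-; ring.
have [] := heights_indep n01 n02 n12 rel.
have cf (a b : R) : 2 * a *: 'X + b%:P = 0 :> {poly R} -> a = 0.
  move/(congr1 (coefp 1)); rewrite /coefp !coefE /= => h; lra.
move=> /cf Q01 /cf Q02 /cf Q12.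
suff: \forall t \near F, False by move/filter_const.
near=> t.
have [ct Ht EH] : [/\ c t != 0, H t != 0 & E t ^+ 2 + H t ^+ 2 = 2 * S t + c t ^+ 2].
  by near: t.
have [[_ l0] [_ l1] [_ l2]] : [/\ labelled (c t) (E t) (H t) (S t) s0 d0 u0 (g0 t),
      labelled (c t) (E t) (H t) (S t) s1 d1 u1 (g1 t) &
      labelled (c t) (E t) (H t) (S t) s2 d2 u2 (g2 t)] by near: t.
(* [H] times the determinant is [c] times the constant [L1 * N2 - L2 * N1], so it suffices that the
   square of this constant is zero. *)
have /negP : det3 d0 (g0 t) d1 (g1 t) d2 (g2 t) != 0 by near: t.
apply; rewrite -(inj_eq (mulfI Ht)) mulr0.
have -> : H t * det3 d0 (g0 t) d1 (g1 t) d2 (g2 t) = c t * (L1 * N2 - L2 * N1).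
  transitivity ((d1 - d0) * ((E t * d2 + H t * g2 t) - (E t * d0 + H t * g0 t))
      - (d2 - d0) * ((E t * d1 + H t * g1 t) - (E t * d0 + H t * g0 t))).
    by rewrite /det3; ring.
  by rewrite l0 l1 l2 /L1 /L2 /N1 /N2; ring.
rewrite mulf_eq0 (negPf ct) /= -sqrf_eq0; apply/eqP.
(* Because of the zero sums, equality of the mixed products of the [N] and of the [L] entails
   equality of their squares. *)
have LL1 : N1 ^+ 2 = L1 ^+ 2.
  have -> : N1 ^+ 2 = - (N0 * N1 - L0 * L1) - (N1 * N2 - L1 * L2) - L1 * (L0 + L2).
    by rewrite /N0 /N1 /N2; ring.
  by rewrite Q01 Q12 /L0 /L1 /L2; ring.
have LL2 : N2 ^+ 2 = L2 ^+ 2.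
  have -> : N2 ^+ 2 = - (N0 * N2 - L0 * L2) - (N1 * N2 - L1 * L2) - L2 * (L0 + L1).
    by rewrite /N0 /N1 /N2; ring.
  by rewrite Q02 Q12 /L0 /L1 /L2; ring.
have -> : (L1 * N2 - L2 * N1) ^+ 2 =
  L1 ^+ 2 * N2 ^+ 2 + L2 ^+ 2 * N1 ^+ 2 - 2 * (L1 * L2) * (N1 * N2) by ring.
by rewrite LL1 LL2 (subr0_eq Q12); ring.
Unshelve. all: by end_near. Qed.

Lemma near_False : (\forall t \near F, False) -> False.
Proof. by move/filter_const. Qed.

(** Here q0 and q1 are mirror images in the perpendicular bisector of p0 p1. The conclusion is
    metric: p2 projects to p0 or p1, and its height is the sum of those of q0 and q2, so both parts
    are centred at the same height. *)
Lemma antiparallelogram_relations : s1 = s0 -> d1 = - d0 ->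
  (\forall t \near F, g1 t = g0 t) ->
  d2 ^+ 2 = d0 ^+ 2 /\
  \forall t \near F, E t ^+ 2 = c t ^+ 2 /\ H t = g0 t + g2 t.
Proof.
move=> ss dd gg.
have d0n : d0 != 0.
  apply/eqP => d00; apply: near_False.
  apply: filterS2 gg noncol => t gt; rewrite /det3 dd d00 gt => /negP; apply.
  by apply/eqP; ring.
(* Difference and sum of the equations of q0 and q1 give [E = c * Tt] and [S = H * g0 - c * V]. The
   equation of q2 then gives [H * (g2 - g0) = c * W]. *)
pose Tt := (u0 - u1) / (2 * d0); pose V := (u0 + u1) / 2.
pose W := u2 - V - Tt * d2; pose A := Tt ^+ 2 - 1.
have uT : u0 - u1 = 2 * d0 * Tt by rewrite /Tt; field.
have [u0E u1E] : u0 = V + d0 * Tt /\ u1 = V - d0 * Tt.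
  by rewrite /V; split; lra.
have rel : \forall t \near F, [/\ E t = c t * Tt, H t * (g2 t - g0 t) = c t * W,
    g0 t ^+ 2 = - c t ^+ 2 + 2 * s0 * c t - d0 ^+ 2,
    g2 t ^+ 2 = - c t ^+ 2 + 2 * s2 * c t - d2 ^+ 2 &
    (c t * A + 2 * V) * (g2 t ^+ 2 + g0 t ^+ 2 - 2 * (g0 t * g2 t)) + c t * W ^+ 2
    - 2 * W * (g0 t * g2 t - g0 t ^+ 2) = 0].
  apply: filterS3 base lab gg => t [ct Ht EH] [[G0 l0] [G1 l1] [G2 l2]] gt.
  rewrite gt dd u1E in l1; rewrite u0E in l0.
  have Et : E t = c t * Tt by apply: (mulfI d0n); lra.
  have Sv : S t = H t * g0 t - c t * V by lra.
  have Hg : H t * (g2 t - g0 t) = c t * W.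
    have -> : H t * (g2 t - g0 t) = (E t * d2 + H t * g2 t) - E t * d2 - H t * g0 t by ring.
    by rewrite l2 Sv Et /W; ring.
  split=> //; apply: (mulfI ct); rewrite mulr0.
  transitivity ((E t ^+ 2 - 2 * S t - c t ^+ 2) * (g2 t - g0 t) ^+ 2
     + (H t * (g2 t - g0 t)) ^+ 2).
    have e : H t * g0 t * (g2 t - g0 t) ^+ 2 = c t * W * (g0 t * (g2 t - g0 t)).
      by rewrite -Hg; ring.
    rewrite Hg Sv Et /A; lra.
  transitivity ((E t ^+ 2 + H t ^+ 2 - (2 * S t + c t ^+ 2)) * (g2 t - g0 t) ^+ 2);
    first by ring.
  by rewrite EH subrr mul0r.
have g2g0 : \forall t \near F, g2 t != g0 t.
  apply: filterS2 noncol gg => t; rewrite /det3 => + gt.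
  by apply: contra => /eqP ->; rewrite gt; apply/eqP; ring.
have Wn : W != 0.
  apply/eqP => W0; apply: near_False.
  apply: filterS3 base rel g2g0 => t [_ Ht _] [_ Hg _ _ _] /negP; apply.
  by move/eqP: Hg; rewrite W0 mulr0 mulf_eq0 (negPf Ht) subr_eq0.
(* If q2 shares the invariants of q0, then [g2 = - g0] and the relation is polynomial in [c] alone;
   its coefficients contradict [Wn]. *)
have [[s20 d20]|ne] := pselect (s0 = s2 /\ d0 ^+ 2 = d2 ^+ 2).
  have gm : \forall t \near F, g2 t = - g0 t.
    apply: filterS2 rel g2g0 => t [_ _ G0 G2 _] /negPf gn.
    have /eqP : g2 t ^+ 2 = g0 t ^+ 2 by rewrite G0 G2 s20 d20.
    by rewrite eqf_sqr gn /= => /eqP.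
  have cf : forall i, [:: - 4 * d0 ^+ 2 * (2 * V + W);
    - 4 * d0 ^+ 2 * A + 8 * s0 * (2 * V + W) + W ^+ 2;
    8 * s0 * A - 4 * (2 * V + W); - 4 * A]`_i = 0.
    apply: indep1; apply: filterS2 rel gm => t [_ _ G0 _ <-] ->; rewrite /=.
    transitivity (4 * (- c t ^+ 2 + 2 * s0 * c t - d0 ^+ 2) *
      (c t * A + 2 * V + W) + c t * W ^+ 2); first by ring.
    by rewrite -G0; ring.
  have := cf 3; have := cf 2; have := cf 1%N => /= c1 c2 c3.
  have A0 : A = 0 by lra.
  have B0 : 2 * V + W = 0 by rewrite A0 in c2; lra.
  by exfalso; move/negP: Wn; apply; rewrite -sqrf_eq0 -c1 A0 B0; apply/eqP; ring.
have [P0 Q0] : (forall i, [:: - 2 * V * (d2 ^+ 2 + d0 ^+ 2) - 2 * W * d0 ^+ 2;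
    - A * (d2 ^+ 2 + d0 ^+ 2) + 4 * V * (s2 + s0) + W ^+ 2 + 4 * W * s0;
    2 * A * (s2 + s0) - 4 * V - 2 * W; - 2 * A]`_i = 0) /\
    (forall i, [:: - 4 * V - 2 * W; - 2 * A]`_i = 0).
  apply: (indep2 (g := g0) (g' := g2) ds0 ne).
  - by apply: filterS rel => t [].
  - by apply: filterS rel => t [].
  apply: filterS rel => t [_ _ G0 G2 <-] /=.
  transitivity ((c t * A + 2 * V) * ((- c t ^+ 2 + 2 * s2 * c t - d2 ^+ 2)
    + (- c t ^+ 2 + 2 * s0 * c t - d0 ^+ 2) - 2 * (g0 t * g2 t)) + c t * W ^+ 2
    - 2 * W * (g0 t * g2 t - (- c t ^+ 2 + 2 * s0 * c t - d0 ^+ 2))); first by ring.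
  by rewrite -G0 -G2.
have := Q0 0%N; have := P0 0%N; have := P0 1%N; have := P0 3 => /= c3 c1 e0 q0.
have A0 : A = 0 by lra.
have WE : W = - 2 * V by lra.
have Vn : V != 0 by apply: contra Wn => /eqP V0; rewrite WE V0 mulr0.
have VE : V = s0 - s2.
  by apply: (mulfI Vn); move: c1; rewrite A0 WE => h; lra.
have dE : d2 ^+ 2 = d0 ^+ 2.
  by apply: (mulfI Vn); move: e0; rewrite WE => h; lra.
split=> //; apply: filterS2 rel g2g0 => t [-> Hg G0 G2 _] gn; split.
  by rewrite exprMn (_ : Tt ^+ 2 = 1) ?mulr1 //; apply/subr0_eq.
apply: (@mulIf _ (g2 t - g0 t)); first by rewrite subr_eq0.
rewrite Hg WE VE (_ : (g0 t + g2 t) * _ = g2 t ^+ 2 - g0 t ^+ 2); last ring.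
by rewrite G0 G2 dE; ring.
Qed.

(** Here q0 and q1 are mirror images in the line p0 p1. The coefficients force [d0 = 0]: the kite is
    a rhombus, hence a parallelogram, and the conclusion has the form of that case. *)
Lemma kite_relations : 0 < s0 -> s1 = s0 -> d1 = d0 ->
  (\forall t \near F, g1 t = - g0 t) ->
  ~ (s0 = s2 /\ d0 ^+ 2 = d2 ^+ 2) ->
  [/\ d0 = 0, s2 = s0 & exists2 e : R, e ^+ 2 = 1 & \forall t \near F,
    [/\ E t ^+ 2 + H t ^+ 2 = c t ^+ 2, E t * d0 + H t * g0 t = e * c t * d2 &
     E t * d2 + H t * g2 t = e * c t * d0]].
Proof.
move=> s00 ss dd gg ne.
pose U := (u0 - u1) / 2; pose V := (u0 + u1) / 2.
pose W := u2 - V; pose k := d2 - d0.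
have [u0E u1E] : u0 = V + U /\ u1 = V - U by rewrite /V /U; split; lra.
have nz : \forall t \near F, k != 0 /\ g0 t != 0.
  apply: filterS2 noncol gg => t; rewrite /det3 dd => + gt; rewrite gt.
  rewrite (_ : _ - _ = 2 * (k * g0 t)); last by rewrite /k; ring.
  by rewrite !mulf_eq0 !negb_or => /and3P[].
have kn : k != 0 by apply: (@filter_const _ F); apply: filterS nz => t [].
have rel : \forall t \near F, [/\ H t * g0 t = c t * U, S t = E t * d0 - c t * V,
    E t * k + H t * g2 t = c t * W,
    g0 t ^+ 2 = - c t ^+ 2 + 2 * s0 * c t - d0 ^+ 2 /\
    g2 t ^+ 2 = - c t ^+ 2 + 2 * s2 * c t - d2 ^+ 2 &
    c t * (W ^+ 2 * g0 t ^+ 2 + U ^+ 2 * g2 t ^+ 2 - 2 * W * U * (g0 t * g2 t))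
    + k ^+ 2 * c t * U ^+ 2 - 2 * d0 * k * (W * g0 t ^+ 2 - U * (g0 t * g2 t))
    - (c t - 2 * V) * k ^+ 2 * g0 t ^+ 2 = 0].
  apply: filterS3 base lab gg => t [ct Ht EH] [[G0 l0] [G1 l1] [G2 l2]] gt.
  rewrite gt dd u1E in l1; rewrite u0E in l0.
  have Hg : H t * g0 t = c t * U by lra.
  have St : S t = E t * d0 - c t * V by lra.
  have Ek : E t * k + H t * g2 t = c t * W.
    by rewrite /k /W mulrBr mulrBr; lra.
  split=> //; apply: (mulfI ct); rewrite mulr0.
  have Eg : E t * k * g0 t = c t * (W * g0 t - U * g2 t).
    rewrite (_ : E t * k = c t * W - H t * g2 t); last by rewrite -Ek; ring.
    transitivity (c t * W * g0 t - (H t * g0 t) * g2 t); first by ring.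
    by rewrite Hg; ring.
  transitivity ((c t * (W * g0 t - U * g2 t)) ^+ 2 + k ^+ 2 * (c t * U) ^+ 2
     - 2 * d0 * k * g0 t * (c t * (W * g0 t - U * g2 t))
     + (2 * c t * V - c t ^+ 2) * k ^+ 2 * g0 t ^+ 2); first by ring.
  rewrite -Eg -Hg.
  transitivity ((E t ^+ 2 + H t ^+ 2 - (2 * (E t * d0 - c t * V) + c t ^+ 2))
     * k ^+ 2 * g0 t ^+ 2); first by ring.
  by rewrite EH St subrr !mul0r.
have Un : U != 0.
  apply/eqP => U0; apply: near_False.
  apply: filterS3 base rel nz => t [_ Ht _] [Hg _ _ _ _] [_ gn].
  by move/eqP: Hg; rewrite U0 mulr0 mulf_eq0 (negPf Ht) (negPf gn).
have [P0 Q0] : (forall i, [:: 2 * d0 * k * W * d0 ^+ 2 - 2 * V * k ^+ 2 * d0 ^+ 2;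
    - W ^+ 2 * d0 ^+ 2 - U ^+ 2 * d2 ^+ 2 + k ^+ 2 * U ^+ 2 - 4 * d0 * k * W * s0
      + k ^+ 2 * d0 ^+ 2 + 4 * V * k ^+ 2 * s0;
    2 * W ^+ 2 * s0 + 2 * U ^+ 2 * s2 + 2 * d0 * k * W - 2 * s0 * k ^+ 2
     - 2 * V * k ^+ 2;
    - W ^+ 2 - U ^+ 2 + k ^+ 2]`_i = 0) /\
    (forall i, [:: 2 * d0 * k * U; - 2 * W * U]`_i = 0).
  apply: (indep2 (g := g0) (g' := g2) ds0 ne).
  - by apply: filterS rel => t [_ _ _ []].
  - by apply: filterS rel => t [_ _ _ []].
  apply: filterS rel => t [_ _ _ [G0 G2] <-] /=.
  by rewrite G0 G2; ring.
have := Q0 0%N; have := Q0 1%N; have := P0 1%N; have := P0 2; have := P0 3 => /=.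
move=> e3 e2 e1 q1 q0.
have W0 : W = 0 by apply: (mulIf Un); lra.
have d00 : d0 = 0 by apply: (mulIf Un); apply: (mulIf kn); lra.
have kE : k = d2 by rewrite /k d00 subr0.
have UE : U ^+ 2 = d2 ^+ 2 by move: e3; rewrite W0 kE => h; lra.
rewrite kE in kn.
have dn : d2 ^+ 2 != 0 by rewrite sqrf_eq0.
have V0 : V = 0.
  apply: (mulIf dn); apply: (mulIf (lt0r_neq0 s00)).
  by move: e1; rewrite W0 d00 kE UE => h; lra.
have sE : s2 = s0.
  apply: (mulIf dn); by move: e2; rewrite W0 V0 d00 kE UE => h; lra.
split=> //; exists (U / d2).
  by rewrite expr_div_n UE divff.
apply: filterS2 base rel => t [_ _ EH] [Hg St Ek _ _].
rewrite d00 V0 in St; rewrite kE W0 in Ek; split.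
- by rewrite EH St; ring.
- by rewrite d00 Hg; field.
- by rewrite d00 Ek; ring.
Qed.

(** Here q0 and q1 are symmetric about the midpoint of p0 p1, so the sum of their equations
    determines [S]. The outcome puts p2 on the circle with diameter p0 p1. Nonzero [d0] makes the
    sign [e = W / d0] meaningful. *)
Lemma parallelogram_relations : 0 < s0 -> 0 < s2 -> d0 != 0 -> s1 = s0 -> d1 = - d0 ->
  (\forall t \near F, g1 t = - g0 t) ->
  ~ (s0 = s2 /\ d0 ^+ 2 = d2 ^+ 2) ->
  s2 = s0 /\ exists2 e : R, e ^+ 2 = 1 & \forall t \near F,
    [/\ E t ^+ 2 + H t ^+ 2 = c t ^+ 2, E t * d0 + H t * g0 t = e * c t * d2 &
     E t * d2 + H t * g2 t = e * c t * d0].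
Proof.
move=> s00 s20 d0n ss dd gg ne.
pose U := (u0 - u1) / 2; pose V := (u0 + u1) / 2.
pose W := u2 - V; pose k := d0 * W - d2 * U.
have [u0E u1E] : u0 = V + U /\ u1 = V - U by rewrite /V /U; split; lra.
pose D t := d0 * g2 t - d2 * g0 t.
have Dn : \forall t \near F, D t != 0.
  apply: filterS2 noncol gg => t + gt; rewrite /det3 dd gt /D.
  rewrite (_ : _ - _ = - 2 * (d0 * g2 t - d2 * g0 t)); last by ring.
  by rewrite mulf_eq0 negb_or => /andP[].
have rel : \forall t \near F, [/\ S t = - (c t * V), E t * d0 + H t * g0 t = c t * U,
    E t * d2 + H t * g2 t = c t * W,
    g0 t ^+ 2 = - c t ^+ 2 + 2 * s0 * c t - d0 ^+ 2 /\
    g2 t ^+ 2 = - c t ^+ 2 + 2 * s2 * c t - d2 ^+ 2 &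
    H t * D t = c t * k /\
    c t * (U ^+ 2 * g2 t ^+ 2 + W ^+ 2 * g0 t ^+ 2 + k ^+ 2 - 2 * U * W * (g0 t * g2 t))
    - (c t - 2 * V) * (d0 ^+ 2 * g2 t ^+ 2 + d2 ^+ 2 * g0 t ^+ 2
       - 2 * d0 * d2 * (g0 t * g2 t)) = 0].
  apply: filterS3 base lab gg => t [ct Ht EH] [[G0 l0] [G1 l1] [G2 l2]] gt.
  rewrite gt dd u1E in l1; rewrite u0E in l0.
  have St : S t = - (c t * V) by lra.
  have e0 : E t * d0 + H t * g0 t = c t * U by lra.
  have e2 : E t * d2 + H t * g2 t = c t * W by rewrite /W mulrBr; lra.
  have HD : H t * D t = c t * k.
    transitivity (d0 * (c t * W) - d2 * (c t * U)); last by rewrite /k; ring.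
    by rewrite -e0 -e2 /D; ring.
  have ED : E t * D t = c t * (U * g2 t - W * g0 t).
    transitivity ((c t * U) * g2 t - (c t * W) * g0 t); last by ring.
    by rewrite -e0 -e2 /D; ring.
  split=> //; split=> //; apply: (mulfI ct); rewrite mulr0.
  transitivity ((c t * (U * g2 t - W * g0 t)) ^+ 2 + (c t * k) ^+ 2
     + (2 * c t * V - c t ^+ 2) * D t ^+ 2); first by rewrite /D; ring.
  rewrite -ED -HD.
  transitivity ((E t ^+ 2 + H t ^+ 2 - (2 * (- (c t * V)) + c t ^+ 2)) * D t ^+ 2).
    by ring.
  by rewrite EH St subrr mul0r.
have [P0 Q0] : (forall i, [:: - 4 * V * d0 ^+ 2 * d2 ^+ 2;
    - (U ^+ 2 * d2 ^+ 2 + W ^+ 2 * d0 ^+ 2) + k ^+ 2 + 2 * d0 ^+ 2 * d2 ^+ 2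
      + 4 * V * (d0 ^+ 2 * s2 + d2 ^+ 2 * s0);
    2 * (U ^+ 2 * s2 + W ^+ 2 * s0) - 2 * (d0 ^+ 2 * s2 + d2 ^+ 2 * s0)
      - 2 * V * (d0 ^+ 2 + d2 ^+ 2);
    - (U ^+ 2 + W ^+ 2) + (d0 ^+ 2 + d2 ^+ 2)]`_i = 0) /\
    (forall i, [:: - 4 * V * d0 * d2; - 2 * U * W + 2 * d0 * d2]`_i = 0).
  apply: (indep2 (g := g0) (g' := g2) ds0 ne).
  - by apply: filterS rel => t [_ _ _ []].
  - by apply: filterS rel => t [_ _ _ []].
  apply: filterS rel => t [_ _ _ [G0 G2] [_ <-]] /=.
  by rewrite G0 G2; ring.
have := Q0 1%N; have := P0 1%N; have := P0 2; have := P0 3 => /=.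
move=> e3 e2 e1 q1.
have UW : U * W = d0 * d2 by lra.
(* The linear coefficient reduces to a multiple of [V] times a sum that is positive because [s0] and
   [s2] are. *)
have V0 : V = 0.
  have h : V * (d0 ^+ 2 * s2 + d2 ^+ 2 * s0) = 0.
    have : (d0 * W - d2 * U) ^+ 2 = U ^+ 2 * d2 ^+ 2 + W ^+ 2 * d0 ^+ 2
       - 2 * d0 * d2 * (U * W) by ring.
    by move: e1; rewrite /k UW => h1 h2; lra.
  move/eqP: h; rewrite mulf_eq0 => /orP[/eqP //|].
  rewrite gt_eqF //; apply: ltr_pwDl.
    by rewrite mulr_gt0 // exprn_even_gt0.
  by rewrite mulr_ge0 ?sqr_ge0 ?ltW.
have UWE : W ^+ 2 = d0 ^+ 2 + d2 ^+ 2 - U ^+ 2 by lra.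
have U1 : (U ^+ 2 - d0 ^+ 2) * (s2 - s0) = 0.
  by move: e2; rewrite V0 UWE => h; lra.
(* Otherwise [k] would vanish, and with it [H * D], although both factors are nonzero. *)
have Und : U ^+ 2 - d0 ^+ 2 != 0.
  apply/negP; rewrite subr_eq0 => /eqP Ud; apply: near_False.
  apply: filterS3 base rel Dn => t [_ Ht _] [_ _ _ _ [HD _]] /negPf Dt.
  have k0 : k = 0.
    apply/eqP; rewrite -sqrf_eq0; apply/eqP.
    have -> : k ^+ 2 = U ^+ 2 * d2 ^+ 2 + W ^+ 2 * d0 ^+ 2
       - 2 * d0 * d2 * (U * W) by rewrite /k; ring.
    by rewrite UW UWE Ud; ring.
  by move/eqP: HD; rewrite k0 mulr0 mulf_eq0 (negPf Ht) Dt.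
have sE : s2 = s0.
  by apply/subr0_eq; apply: (mulfI Und); rewrite U1 mulr0.
have Ud2 : U ^+ 2 = d2 ^+ 2.
  apply/subr0_eq; apply: (mulfI Und); rewrite mulr0.
  transitivity (- (U ^+ 2 * (d0 ^+ 2 + d2 ^+ 2 - U ^+ 2)) + d0 ^+ 2 * d2 ^+ 2).
    by ring.
  rewrite -UWE (_ : U ^+ 2 * W ^+ 2 = (U * W) ^+ 2); last by ring.
  by rewrite UW; ring.
have Wd : W ^+ 2 = d0 ^+ 2 by rewrite UWE Ud2; ring.
split=> //; exists (W / d0).
  by rewrite expr_div_n Wd divff // sqrf_eq0.
have UE : U = W / d0 * d2.
  have Wn : W != 0 by rewrite -sqrf_eq0 Wd sqrf_eq0.
  apply: (mulIf Wn); rewrite UW.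
  rewrite (_ : W / d0 * d2 * W = W ^+ 2 * d2 / d0); last by field.
  by rewrite Wd; field.
apply: filterS2 base rel => t [_ _ EH] [St e0' e2' _ _]; split.
- by rewrite EH St V0; ring.
- by rewrite e0' UE; ring.
- by rewrite e2'; field.
Qed.

End Heights.

(** * From metric relations to rectangles *)

Definition sqd (R : realType) (x y : plane R) : R := dotp (x - y) (x - y).

Definition crossp (R : realType) (u v : plane R) : R := u.1 * v.2 - u.2 * v.1.

Definition rect3 (R : realType) (o e1 e2 : plane R) (a b : R)
    (x0 x1 x2 : plane R) : Prop :=
  [/\ rect_vertices a b (coords o e1 e2 x0),
      rect_vertices a b (coords o e1 e2 x1) &
      rect_vertices a b (coords o e1 e2 x2)].

Definition concentric3 (R : realType) (p0 p1 p2 q0 q1 q2 : plane R) : Prop :=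
  exists o e1 e2 : plane R, orthonormal_frame e1 e2 /\
    exists a b c d : R, [/\ [/\ 0 < a, 0 < b, 0 < c & 0 < d],
      rect3 o e1 e2 a b p0 p1 p2 & rect3 o e1 e2 c d q0 q1 q2].

(** Prescribed squares encode the four sign choices of a vertex algebraically; [u] is an axis
    direction of arbitrary length. *)
Definition frame_sq (R : realType) (o u : plane R) (A B : R) (x : plane R) : Prop :=
  dotp (x - o) u ^+ 2 = A ^+ 2 /\ crossp u (x - o) ^+ 2 = B ^+ 2.

Lemma dotpp_gt0 (R : realType) (u : plane R) : u != 0 -> 0 < dotp u u.
Proof.
move=> u0; rewrite lt_neqAle /dotp addr_ge0 -?expr2 ?sqr_ge0 // andbT.
rewrite eq_sym paddr_eq0 ?sqr_ge0 // !sqrf_eq0.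
by apply: contra u0 => /andP[/eqP a /eqP b]; rewrite -pair_eqE /= a b eqxx.
Qed.

Lemma rect_of_frame_sq (R : realType) (o u : plane R) (A B : R) (x : plane R) :
  u != 0 -> frame_sq o u A B x ->
  let r := Num.sqrt (dotp u u) in
  rect_vertices (`|A| / r) (`|B| / r)
    (coords o (u.1 / r, u.2 / r) (- u.2 / r, u.1 / r) x).
Proof.
move=> u0 [hA hB] r.
have r0 : r != 0 by rewrite gt_eqF // sqrtr_gt0 dotpp_gt0.
have key (a A' : R) : a ^+ 2 = A' ^+ 2 -> a / r = `|A'| / r \/ a / r = - (`|A'| / r).
  move=> /eqP; rewrite eqf_sqr; case: (ler0P A') => _ /orP[] /eqP ->;
    [by right; rewrite mulNr opprK|by left|by left|by right; rewrite mulNr].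
split; rewrite /coords /=.
  rewrite (_ : dotp _ _ = dotp (x - o) u / r); last by rewrite /dotp /=; ring.
  exact: key.
rewrite (_ : dotp _ _ = crossp u (x - o) / r); last by rewrite /dotp /crossp /=; ring.
exact: key.
Qed.

Lemma concentric3_of_frame_sq (R : realType) (o u : plane R) (A B C D : R)
    (p0 p1 p2 q0 q1 q2 : plane R) :
  u != 0 -> A != 0 -> B != 0 -> C != 0 -> D != 0 ->
  frame_sq o u A B p0 -> frame_sq o u A B p1 -> frame_sq o u A B p2 ->
  frame_sq o u C D q0 -> frame_sq o u C D q1 -> frame_sq o u C D q2 ->
  concentric3 p0 p1 p2 q0 q1 q2.
Proof.
move=> u0 A0 B0 C0 D0 hp0 hp1 hp2 hq0 hq1 hq2.
set r := Num.sqrt (dotp u u).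
have r0 : 0 < r by rewrite sqrtr_gt0 dotpp_gt0.
have r2 : r ^+ 2 = dotp u u by rewrite sqr_sqrtr // ltW // dotpp_gt0.
have rn : r != 0 by rewrite gt_eqF.
exists o, (u.1 / r, u.2 / r), (- u.2 / r, u.1 / r); split.
  split; rewrite {1}/dotp /=.
  - rewrite (_ : _ + _ = dotp u u / r ^+ 2); last by rewrite /dotp; field.
    by rewrite -r2 divff // sqrf_eq0.
  - rewrite (_ : _ + _ = dotp u u / r ^+ 2); last by rewrite /dotp; field.
    by rewrite -r2 divff // sqrf_eq0.
  - by ring.
exists (`|A| / r), (`|B| / r), (`|C| / r), (`|D| / r).
by split; [split; rewrite divr_gt0 ?normr_gt0 //|split; exact: rect_of_frame_sq..].
Qed.

(* Coordinates along and across p0 p1, from its midpoint, scaled by twice the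
   length of p0 p1. *)
Definition sx (R : realType) (p0 p1 x : plane R) : R := sqd x p0 - sqd x p1.
Definition sy (R : realType) (p0 p1 x : plane R) : R :=
  2 * crossp (p1 - p0) (x - p0).

Definition scaled_sq (R : realType) (p0 p1 : plane R) (ox oy al be A B : R)
    (x : plane R) : Prop :=
  ((sx p0 p1 x - ox) * al + (sy p0 p1 x - oy) * be) ^+ 2 = A ^+ 2 /\
  (al * (sy p0 p1 x - oy) - be * (sx p0 p1 x - ox)) ^+ 2 = B ^+ 2.

Lemma concentric3_of_scaled_sq (R : realType) (ox oy al be A B C D : R)
    (p0 p1 p2 q0 q1 q2 : plane R) :
  sqd p1 p0 != 0 -> A != 0 -> B != 0 -> C != 0 -> D != 0 ->
  let sq A B := scaled_sq p0 p1 ox oy al be A B in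
  sq A B p0 -> sq A B p1 -> sq A B p2 -> sq C D q0 -> sq C D q1 -> sq C D q2 ->
  concentric3 p0 p1 p2 q0 q1 q2.
Proof.
move=> c0 A0 B0 C0 D0 sq.
pose v : plane R := p1 - p0; pose c := sqd p1 p0.
(* In complex notation [u] is ([al] + i [be]) [v], and [o] is the midpoint of p0 p1 plus ([ox] + i
   [oy]) [v] / (2 [c]), which undoes the scaling of [sx] and [sy]. *)
pose u : plane R := (al * v.1 - be * v.2, al * v.2 + be * v.1).
pose o : plane R := ((p0.1 + p1.1) / 2 + (ox * v.1 - oy * v.2) / (2 * c),
  (p0.2 + p1.2) / 2 + (ox * v.2 + oy * v.1) / (2 * c)).
have e1 x : dotp (x - o) u = ((sx p0 p1 x - ox) * al + (sy p0 p1 x - oy) * be) / 2.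
  rewrite /o /u /sx /sy /c /v /sqd /crossp /dotp /=; field.
  exact: c0.
have e2 x : crossp u (x - o) = (al * (sy p0 p1 x - oy) - be * (sx p0 p1 x - ox)) / 2.
  rewrite /o /u /sx /sy /c /v /sqd /crossp /dotp /=; field.
  exact: c0.
have key X Y x : sq X Y x -> frame_sq o u (X / 2) (Y / 2) x.
  by move=> [h1 h2]; rewrite /frame_sq e1 e2 !expr_div_n h1 h2.
have h2 (X : R) : X != 0 -> X / 2 != 0.
  by move=> X0; rewrite mulf_neq0 ?invr_eq0.
have un : sq A B p0 -> u != 0.
  move=> /key [h _]; apply: contra (h2 _ A0) => /eqP u0.
  by rewrite -sqrf_eq0 -h u0 /dotp /= !mulr0 addr0 expr0n.
move=> hp0 hp1 hp2 hq0 hq1 hq2.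
apply: (@concentric3_of_frame_sq _ o u (A / 2) (B / 2) (C / 2) (D / 2));
  solve [exact: un|exact: h2|exact: key].
Qed.

Lemma sx_base (R : realType) (p0 p1 : plane R) :
  [/\ sx p0 p1 p0 = - sqd p1 p0, sx p0 p1 p1 = sqd p1 p0,
      sy p0 p1 p0 = 0 & sy p0 p1 p1 = 0].
Proof. by rewrite /sx /sy /sqd /dotp /crossp /=; split; ring. Qed.

(** The axes are those of the frame of p0 p1, and the centre lies on the perpendicular bisector at
    half the height of p2. *)
Lemma concentric3_antiparallelogram (R : realType) (p0 p1 p2 q0 q1 q2 : plane R)
    (X := sx p0 p1) (Y := sy p0 p1) (c := sqd p1 p0) :
  c != 0 -> Y p2 != 0 -> det3 (X q0) (Y q0) (X q1) (Y q1) (X q2) (Y q2) != 0 ->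
  X q1 = - X q0 -> Y q1 = Y q0 -> X q2 ^+ 2 = X q0 ^+ 2 ->
  X p2 ^+ 2 = c ^+ 2 -> Y p2 = Y q0 + Y q2 -> concentric3 p0 p1 p2 q0 q1 q2.
Proof.
move=> c0 H0; rewrite /det3 => + X1 Y1 X2 Xp Yp; rewrite X1 Y1 => dn.
have [Xp0 Xp1 Yp0 Yp1] := sx_base p0 p1.
have Xn : X q0 != 0 by apply: contra dn => /eqP ->; apply/eqP; ring.
have Yn : Y q2 - Y q0 != 0 by apply: contra dn => /eqP ->; apply/eqP; ring.
have hn (a : R) : a != 0 -> a / 2 != 0 by move=> a0; rewrite mulf_neq0 ?invr_eq0.
apply: (@concentric3_of_scaled_sq _ 0 (Y p2 / 2) 1 0 c (Y p2 / 2) (X q0)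
  ((Y q2 - Y q0) / 2)); rewrite ?hn //;
  rewrite /scaled_sq ?Xp0 ?Xp1 ?Yp0 ?Yp1 -/X -/Y -/c;
  rewrite ?X1 ?Y1 ?mulr0 ?mulr1 ?mul1r ?mul0r ?subr0 ?addr0 ?X2 ?Xp ?Yp; split;
  by field.
Qed.

(** The centre is the midpoint of p0 p1. As p1 and p2 are equidistant from it, one axis bisects the
    angle between p2 and [e] times p1; its direction is [(al, H)]. *)
Lemma concentric3_parallelogram (R : realType) (p0 p1 p2 q0 q1 q2 : plane R)
    (X := sx p0 p1) (Y := sy p0 p1) (c := sqd p1 p0) (e : R) :
  c != 0 -> Y p2 != 0 -> det3 (X q0) (Y q0) (X q1) (Y q1) (X q2) (Y q2) != 0 ->
  X q1 = - X q0 -> Y q1 = - Y q0 -> e ^+ 2 = 1 ->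
  X q2 ^+ 2 + Y q2 ^+ 2 = X q0 ^+ 2 + Y q0 ^+ 2 ->
  X p2 ^+ 2 + Y p2 ^+ 2 = c ^+ 2 ->
  X p2 * X q0 + Y p2 * Y q0 = e * c * X q2 ->
  X p2 * X q2 + Y p2 * Y q2 = e * c * X q0 -> concentric3 p0 p1 p2 q0 q1 q2.
Proof.
move=> c0 H0; rewrite /det3 => + X1 Y1 e2 qc pc h0 h2; rewrite X1 Y1 => dn.
have [Xp0 Xp1 Yp0 Yp1] := sx_base p0 p1.
set E := X p2 in pc h0 h2 *; set H := Y p2 in H0 pc h0 h2 *.
pose al := E + e * c.
have aln : al != 0.
  apply: contra H0 => /eqP al0; rewrite -sqrf_eq0.
  have -> : H ^+ 2 = c ^+ 2 - E ^+ 2 by rewrite -pc; ring.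
  have -> : E = - (e * c) by apply/eqP; rewrite -addr_eq0; apply/eqP.
  by rewrite sqrrN exprMn e2 mul1r subrr.
have dn' : X q0 * Y q2 - X q2 * Y q0 != 0.
  apply: contra dn => /eqP h; apply/eqP.
  by transitivity (- 2 * (X q0 * Y q2 - X q2 * Y q0)); [ring|rewrite h mulr0].
have dq0 : X q0 * al + Y q0 * H = e * c * (X q0 + X q2).
  by rewrite /al; lra.
have dq2 : X q2 * al + Y q2 * H = e * c * (X q0 + X q2).
  by rewrite /al; lra.
(* Lagrange's identity: the square of the coordinate across the axis follows from the norm and the
   coordinate along it. *)
have Lag (x y : R) : (al * y - H * x) ^+ 2 =
  (al ^+ 2 + H ^+ 2) * (x ^+ 2 + y ^+ 2) - (x * al + y * H) ^+ 2 by ring.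
have Cn : X q0 * al + Y q0 * H != 0.
  apply/negP => /eqP C0; move: dn' => /negP; apply; apply/eqP.
  have C2 : X q2 * al + Y q2 * H = 0 by rewrite dq2 -dq0.
  apply: (mulIf aln); rewrite mul0r.
  transitivity ((X q0 * al + Y q0 * H) * Y q2 - (X q2 * al + Y q2 * H) * Y q0); first by ring.
  by rewrite C0 C2; ring.
have Dn : al * Y q0 - H * X q0 != 0.
  apply/negP => /eqP D0; move: dn' => /negP; apply; apply/eqP.
  have D2 : al * Y q2 - H * X q2 = 0.
    by apply/eqP; rewrite -sqrf_eq0 Lag qc dq2 -dq0 -Lag D0 expr0n.
  apply: (mulIf aln); rewrite mul0r.
  transitivity ((al * Y q2 - H * X q2) * X q0 - (al * Y q0 - H * X q0) * X q2); first by ring.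
  by rewrite D0 D2; ring.
apply: (concentric3_of_scaled_sq (ox := 0) (oy := 0) (al := al) (be := H) c0
  (mulf_neq0 c0 aln) (mulf_neq0 c0 H0) Cn Dn);
  rewrite /scaled_sq ?Xp0 ?Xp1 ?Yp0 ?Yp1 -/X -/Y -/c ?X1 ?Y1 ?subr0;
  rewrite -/E -/H; clearbody E H c X Y; split; try by ring.
- rewrite (_ : E * al + H * H = (E ^+ 2 + H ^+ 2) + e * c * E);
    last by rewrite /al; ring.
  rewrite pc; transitivity (c ^+ 2 * (c ^+ 2 + 2 * e * c * E + e ^+ 2 * E ^+ 2)); first by ring.
  rewrite e2; transitivity (c ^+ 2 * (e ^+ 2 * c ^+ 2 + 2 * e * c * E + E ^+ 2)).
    by rewrite e2; ring.
  by rewrite /al; ring.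
- rewrite (_ : al * H - H * E = e * c * H); last by rewrite /al; ring.
  by rewrite !exprMn e2 mul1r.
- by rewrite dq2 dq0.
- by rewrite Lag dq2 qc -dq0 -Lag.
Qed.

Section Limits.
Context (R : realType) (T : Type) (F : set_system T) {FF : ProperFilter F}.

Lemma cvg_coord (x : T -> plane R) (X : plane R) : x @ F --> X ->
  (fun t => (x t).1) @ F --> X.1 /\ (fun t => (x t).2) @ F --> X.2.
Proof.
by move=> xX; split; apply: (cvg_comp _ _ xX); [exact: cvg_fst|exact: cvg_snd].
Qed.

Lemma cvg_dotp (x y : T -> plane R) (X Y : plane R) :
  x @ F --> X -> y @ F --> Y -> (fun t => dotp (x t) (y t)) @ F --> dotp X Y.
Proof.
move=> /cvg_coord[x1 x2] /cvg_coord[y1 y2]; rewrite /dotp.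
by apply: cvgD; apply: cvgM.
Qed.

Lemma cvg_crossp (x y : T -> plane R) (X Y : plane R) :
  x @ F --> X -> y @ F --> Y -> (fun t => crossp (x t) (y t)) @ F --> crossp X Y.
Proof.
move=> /cvg_coord[x1 x2] /cvg_coord[y1 y2]; rewrite /crossp.
by apply: cvgB; apply: cvgM.
Qed.

Lemma cvg_sqd (x y : T -> plane R) (X Y : plane R) :
  x @ F --> X -> y @ F --> Y -> (fun t => sqd (x t) (y t)) @ F --> sqd X Y.
Proof. by move=> xX yY; apply: cvg_dotp; apply: cvgB. Qed.

Lemma cvg_sx (x y z : T -> plane R) (X Y Z : plane R) :
  x @ F --> X -> y @ F --> Y -> z @ F --> Z ->
  (fun t => sx (x t) (y t) (z t)) @ F --> sx X Y Z.
Proof. by move=> xX yY zZ; apply: cvgB; apply: cvg_sqd. Qed.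

Lemma cvg_sy (x y z : T -> plane R) (X Y Z : plane R) :
  x @ F --> X -> y @ F --> Y -> z @ F --> Z ->
  (fun t => sy (x t) (y t) (z t)) @ F --> sy X Y Z.
Proof.
move=> xX yY zZ; apply: cvgM; first exact: cvg_cst.
by apply: cvg_crossp; apply: cvgB.
Qed.

Lemma cvg_sqr (f : T -> R) (a : R) :
  f @ F --> a -> (fun t => f t ^+ 2) @ F --> a ^+ 2.
Proof. by move=> fa; rewrite expr2; under eq_fun do rewrite expr2; exact: cvgM. Qed.

Lemma near_eq_lim (f g : T -> R) (a b : R) :
  f @ F --> a -> g @ F --> b -> (\forall t \near F, f t = g t) -> a = b.
Proof.
move=> fa gb fg; apply/subr0_eq/eqP/negPn/negP => ab.
have h : (fun t => f t - g t) @ F --> a - b by exact: cvgB.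
apply: (@filter_const _ F); apply: filterS2 fg (cvg_neq _ h ab) => t ->.
by rewrite subrr eqxx.
Qed.

Lemma cvg_det3 (d0 d1 d2 : R) (x y z : T -> R) (X Y Z : R) :
  x @ F --> X -> y @ F --> Y -> z @ F --> Z ->
  (fun t => det3 d0 (x t) d1 (y t) d2 (z t)) @ F --> det3 d0 X d1 Y d2 Z.
Proof.
by move=> xX yY zZ; apply: cvgB; (apply: cvgM; first exact: cvg_cst);
  apply: cvgB => //; exact: cvg_cst.
Qed.

End Limits.

Lemma labelled_points (R : realType) (p0 p1 p2 q : plane R)
    (c := sqd p1 p0) (E := sx p0 p1 p2) (H := sy p0 p1 p2)
    (x := sqd q p0) (y := sqd q p1) (z := sqd q p2) :
  labelled c E H ((E ^+ 2 + H ^+ 2 - c ^+ 2) / 2) (x + y) (x - y)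
    (x + y - 2 * z) (sy p0 p1 q).
Proof.
rewrite /labelled /c /E /H /x /y /z /sx /sy /sqd /crossp /dotp /=.
by split; field.
Qed.

(** * Flexes with three non-collinear joints in each part *)

Section K33.
Context (R : realType) (T : Type) (F : set_system T) {FU : UltraFilter F}.
Context (p0 p1 p2 : T -> plane R) (P0 P1 P2 : plane R).

(** Lower case stands for positions along the flex, upper case for their limits at the moment of
    departure. *)
Definition moving_joint (q : T -> plane R) (Q : plane R) : Prop :=
  [/\ q @ F --> Q,
    \forall t \near F, [/\ sqd (q t) (p0 t) = sqd Q P0,
      sqd (q t) (p1 t) = sqd Q P1 & sqd (q t) (p2 t) = sqd Q P2] &
    [/\ 0 < sqd Q P0, 0 < sqd Q P1 & 0 < sqd Q P2]].

Definition moving_triangle : Prop :=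
  [/\ p0 @ F --> P0, p1 @ F --> P1, p2 @ F --> P2,
    \forall t \near F, sqd (p1 t) (p0 t) != sqd P1 P0 &
    sqd P1 P0 != 0 /\ sy P0 P1 P2 != 0].

Hypothesis moving : moving_triangle.

Definition moving_K33 (q0 q1 q2 : T -> plane R) (Q0 Q1 Q2 : plane R) : Prop :=
  [/\ moving_joint q0 Q0, moving_joint q1 Q1, moving_joint q2 Q2 &
    det3 (sx P0 P1 Q0) (sy P0 P1 Q0) (sx P0 P1 Q1) (sy P0 P1 Q1)
      (sx P0 P1 Q2) (sy P0 P1 Q2) != 0].

Lemma moving_K33_swap01 q0 q1 q2 Q0 Q1 Q2 :
  moving_K33 q0 q1 q2 Q0 Q1 Q2 -> moving_K33 q1 q0 q2 Q1 Q0 Q2.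
Proof.
move=> [? ? ? dn]; split=> //; apply: contra dn; rewrite /det3 => /eqP h.
by apply/eqP; apply/oppr_inj; rewrite oppr0 -h; ring.
Qed.

Lemma moving_K33_swap12 q0 q1 q2 Q0 Q1 Q2 :
  moving_K33 q0 q1 q2 Q0 Q1 Q2 -> moving_K33 q0 q2 q1 Q0 Q2 Q1.
Proof.
move=> [? ? ? dn]; split=> //; apply: contra dn; rewrite /det3 => /eqP h.
by apply/eqP; apply/oppr_inj; rewrite oppr0 -h; ring.
Qed.

Lemma concentric3_swap01 x0 x1 x2 y0 y1 y2 :
  @concentric3 R x0 x1 x2 y0 y1 y2 -> concentric3 x0 x1 x2 y1 y0 y2.
Proof.
move=> [ o [e1 [e2 [fr [a [b [c [d [pos hp [? ? ?]]]]]]]]]].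
by exists o, e1, e2; split=> //; exists a, b, c, d.
Qed.

Lemma concentric3_swap12 x0 x1 x2 y0 y1 y2 :
  @concentric3 R x0 x1 x2 y0 y1 y2 -> concentric3 x0 x1 x2 y0 y2 y1.
Proof.
move=> [ o [e1 [e2 [fr [a [b [c [d [pos hp [? ? ?]]]]]]]]]].
by exists o, e1, e2; split=> //; exists a, b, c, d.
Qed.

Let c t := sqd (p1 t) (p0 t).
Let E t := sx (p0 t) (p1 t) (p2 t).
Let H t := sy (p0 t) (p1 t) (p2 t).
Let S t := (E t ^+ 2 + H t ^+ 2 - c t ^+ 2) / 2.
Let g (q : T -> plane R) t := sy (p0 t) (p1 t) (q t).
Let s (Q : plane R) := sqd Q P0 + sqd Q P1.
Let d (Q : plane R) := sx P0 P1 Q.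
Let u (Q : plane R) := s Q - 2 * sqd Q P2.

Let cc0 : c @ F --> sqd P1 P0.
Proof. by case: moving => ? ? ? _ _; exact: cvg_sqd. Qed.

Let cn0 : \forall t \near F, c t != sqd P1 P0.
Proof. by case: moving. Qed.

Let cE : E @ F --> sx P0 P1 P2.
Proof. by case: moving => ? ? ? _ _; exact: cvg_sx. Qed.

Let cH : H @ F --> sy P0 P1 P2.
Proof. by case: moving => ? ? ? _ _; exact: cvg_sy. Qed.

Let base : \forall t \near F,
  [/\ c t != 0, H t != 0 & E t ^+ 2 + H t ^+ 2 = 2 * S t + c t ^+ 2].
Proof.
case: moving => _ _ _ _ [c0 H0].
apply: filterS2 (cvg_neq _ cc0 c0) (cvg_neq _ cH H0) => t ? ?; split=> //.
by rewrite /S; field.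
Qed.

Let lab1 q Q : moving_joint q Q -> \forall t \near F,
  labelled (c t) (E t) (H t) (S t) (s Q) (d Q) (u Q) (g q t).
Proof.
move=> [_ h _]; apply: filterS h => t [x y z].
by rewrite /u /s /d /sx -x -y -z; exact: labelled_points.
Qed.

Let lab q0 q1 q2 Q0 Q1 Q2 : moving_K33 q0 q1 q2 Q0 Q1 Q2 -> \forall t \near F,
  [/\ labelled (c t) (E t) (H t) (S t) (s Q0) (d Q0) (u Q0) (g q0 t),
      labelled (c t) (E t) (H t) (S t) (s Q1) (d Q1) (u Q1) (g q1 t) &
      labelled (c t) (E t) (H t) (S t) (s Q2) (d Q2) (u Q2) (g q2 t)].
Proof.
move=> [/lab1 h0 /lab1 h1 /lab1 h2 _].
by apply: filterS3 h0 h1 h2.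
Qed.

Let cg q Q : moving_joint q Q -> g q @ F --> sy P0 P1 Q.
Proof. by case: moving => ? ? ? _ _ [? _ _]; exact: cvg_sy. Qed.

Let s_gt0 q Q : moving_joint q Q -> 0 < s Q.
Proof. by move=> [_ _ [? ? _]]; rewrite addr_gt0. Qed.

Let ds q Q : moving_joint q Q -> d Q ^+ 2 < s Q ^+ 2.
Proof.
move=> [_ _ [x y _]]; rewrite /d /s /sx -subr_gt0.
rewrite (_ : _ - _ = 4 * (sqd Q P0 * sqd Q P1)); last by ring.
by rewrite !mulr_gt0.
Qed.

Let noncol q0 q1 q2 Q0 Q1 Q2 : moving_K33 q0 q1 q2 Q0 Q1 Q2 ->
  \forall t \near F, det3 (d Q0) (g q0 t) (d Q1) (g q1 t) (d Q2) (g q2 t) != 0.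
Proof.
move=> [/cg h0 /cg h1 /cg h2 dn].
by apply: (cvg_neq _ _ dn); exact: cvg_det3.
Qed.

Lemma K33_antiparallelogram q0 q1 q2 Q0 Q1 Q2 :
  moving_K33 q0 q1 q2 Q0 Q1 Q2 -> s Q1 = s Q0 -> d Q1 = - d Q0 ->
  (\forall t \near F, g q1 t = g q0 t) -> concentric3 P0 P1 P2 Q0 Q1 Q2.
Proof.
move=> K ss dd gg; have [j0 j1 j2 dn] := K.
have [d2 out] := antiparallelogram_relations cc0 cn0 base (ds j0) (lab K) (noncol K)
  ss dd gg.
have [_ _ _ _ [c0 H0]] := moving.
apply: concentric3_antiparallelogram => //.
- exact: near_eq_lim (cg j1) (cg j0) gg.
- apply: (near_eq_lim (cvg_sqr cE) (cvg_sqr cc0)).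
  by apply: filterS out => t [].
- apply: (near_eq_lim cH (g := fun t => g q0 t + g q2 t)).
    by apply: cvgD; exact: cg.
  by apply: filterS out => t [].
Qed.

Lemma K33_parallelogram q0 q1 q2 Q0 Q1 Q2 (e : R) :
  moving_K33 q0 q1 q2 Q0 Q1 Q2 -> s Q2 = s Q0 -> d Q1 = - d Q0 -> e ^+ 2 = 1 ->
  (\forall t \near F, g q1 t = - g q0 t) ->
  (\forall t \near F, [/\ E t ^+ 2 + H t ^+ 2 = c t ^+ 2,
      E t * d Q0 + H t * g q0 t = e * c t * d Q2 &
      E t * d Q2 + H t * g q2 t = e * c t * d Q0]) ->
  concentric3 P0 P1 P2 Q0 Q1 Q2.
Proof.
move=> K ss dd e1 gg out; have [j0 j1 j2 dn] := K.
have [_ _ _ _ [c0 H0]] := moving.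
apply: (concentric3_parallelogram (e := e)) => //.
- apply: near_eq_lim (cg j1) (cvgN (cg j0)) gg.
- have G0 := (labelled_points P0 P1 P2 Q0).1; have G2 := (labelled_points P0 P1 P2 Q2).1.
  rewrite G0 G2 -/(s Q0) -/(s Q2) ss /sx; ring.
- apply: (near_eq_lim (cvgD (cvg_sqr cE) (cvg_sqr cH)) (cvg_sqr cc0)).
  by apply: filterS out => t [].
- apply: (near_eq_lim (F := F) (f := fun t => E t * d Q0 + H t * g q0 t)
    (g := fun t => e * c t * d Q2)).
  + by exact: cvgD (cvgM cE (cvg_cst _)) (cvgM cH (cg j0)).
  + by exact: cvgM (cvgM (cvg_cst e) cc0) (cvg_cst _).
  + by apply: filterS out => t [].
- apply: (near_eq_lim (F := F) (f := fun t => E t * d Q2 + H t * g q2 t)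
    (g := fun t => e * c t * d Q0)).
  + by exact: cvgD (cvgM cE (cvg_cst _)) (cvgM cH (cg j2)).
  + by exact: cvgM (cvgM (cvg_cst e) cc0) (cvg_cst _).
  + by apply: filterS out => t [].
Qed.

(** Equal squares leave a sign at every time; the ultrafilter makes it eventually the same. *)
Let gsq q q' Q Q' : moving_joint q Q -> moving_joint q' Q' ->
  s Q' = s Q -> d Q' ^+ 2 = d Q ^+ 2 ->
  (\forall t \near F, g q' t = g q t) \/ (\forall t \near F, g q' t = - g q t).
Proof.
move=> j j' ss dd; apply: ultra_or.
apply: filterS2 (lab1 j) (lab1 j') => t [G _] [G' _].
have /eqP : g q' t ^+ 2 = g q t ^+ 2 by rewrite G G' ss dd.
by rewrite eqf_sqr => /orP[] /eqP; [left|right].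
Qed.

(** The signs relating the [d] and the [g] of q0 and q1 give four cases: coincidence, which is
    excluded, antiparallelogram, kite and parallelogram. If q2 has the same invariants too, the last
    two contain an antiparallelogram formed by q2 with q0 or q1, or else contradict
    non-collinearity. *)
Lemma K33_equal_pair q0 q1 q2 Q0 Q1 Q2 :
  moving_K33 q0 q1 q2 Q0 Q1 Q2 -> s Q1 = s Q0 -> d Q1 ^+ 2 = d Q0 ^+ 2 ->
  concentric3 P0 P1 P2 Q0 Q1 Q2.
Proof.
move=> K ss dd; have [j0 j1 j2 _] := K.
have : d Q1 = d Q0 \/ d Q1 = - d Q0.
  by move/eqP: dd; rewrite eqf_sqr => /orP[] /eqP; [left|right].
have nd := noncol K; have := nd.
case: (gsq j0 j1 ss dd) => gg nd' [] {}dd.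
- exfalso; apply: (@filter_const _ F); apply: filterS2 nd gg => t + gt.
  by rewrite /det3 gt dd => /negP; apply; apply/eqP; ring.
- exact: K33_antiparallelogram K ss dd gg.
- have [[s2 d2]|ne] := pselect (s Q0 = s Q2 /\ d Q0 ^+ 2 = d Q2 ^+ 2).
    have d2m : d Q2 = - d Q0.
      have /eqP := esym d2; rewrite eqf_sqr => /orP[] /eqP // d20.
      exfalso; apply: (@filter_const _ F); apply: filterS nd => t.
      by rewrite /det3 d20 dd => /negP; apply; apply/eqP; ring.
    have [g2|g2] := gsq j0 j2 (esym s2) (esym d2).
      apply: concentric3_swap12; apply: K33_antiparallelogram (moving_K33_swap12 K) _ d2m g2.
      by rewrite s2.
    apply: concentric3_swap01; apply: concentric3_swap12.
    apply: (@K33_antiparallelogram q1 q2 q0).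
    + exact/moving_K33_swap12/moving_K33_swap01.
    + by rewrite -s2 ss.
    + by rewrite dd.
    + by apply: filterS2 gg g2 => t -> ->.
  have [d0 s2 [e e1 out]] := kite_relations cc0 cn0 base (ds j0) (lab K) nd (s_gt0 j0)
    ss dd gg ne.
  by apply: (K33_parallelogram K s2 _ e1 gg out); rewrite dd d0 oppr0.
(* For [d Q0 = 0] the parallelogram is a rhombus and is handled as a kite. *)
- have [d0|d0] := eqVneq (d Q0) 0.
    have [[s2 d2]|ne] := pselect (s Q0 = s Q2 /\ d Q0 ^+ 2 = d Q2 ^+ 2).
      exfalso; apply: (@filter_const _ F); apply: filterS nd => t.
      have d20 : d Q2 = 0 by apply/eqP; rewrite -sqrf_eq0 -d2 d0 expr0n.
      by rewrite /det3 d20 dd d0 => /negP; apply; apply/eqP; ring.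
    have dd' : d Q1 = d Q0 by rewrite dd d0 oppr0.
    have [_ s2 [e e1 out]] := kite_relations cc0 cn0 base (ds j0) (lab K) nd (s_gt0 j0)
      ss dd' gg ne.
    exact: K33_parallelogram K s2 dd e1 gg out.
  have [[s2 d2]|ne] := pselect (s Q0 = s Q2 /\ d Q0 ^+ 2 = d Q2 ^+ 2).
    have sp : s Q2 = s Q1 by rewrite -s2 ss.
    have /eqP := esym d2; rewrite eqf_sqr => /orP[] /eqP d20; last first.
      have [g2|g2] := gsq j0 j2 (esym s2) (esym d2).
        apply: concentric3_swap12.
        exact: K33_antiparallelogram (moving_K33_swap12 K) (esym s2) d20 g2.
      exfalso; apply: (@filter_const _ F); apply: filterS3 nd gg g2 => t + gt g2t.
      by rewrite /det3 gt g2t d20 dd => /negP; apply; apply/eqP; ring.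
    have [g2|g2] := gsq j0 j2 (esym s2) (esym d2).
      exfalso; apply: (@filter_const _ F); apply: filterS3 nd gg g2 => t + gt g2t.
      by rewrite /det3 gt g2t d20 dd => /negP; apply; apply/eqP; ring.
    apply: concentric3_swap01; apply: concentric3_swap12.
    apply: (@K33_antiparallelogram q1 q2 q0) => //.
    + exact/moving_K33_swap12/moving_K33_swap01.
    + by rewrite dd d20 opprK.
    + by apply: filterS2 gg g2 => t -> ->.
  have [s2 [e e1 out]] := parallelogram_relations cc0 cn0 base (ds j0) (lab K) nd
    (s_gt0 j0) (s_gt0 j2) d0 ss dd gg ne.
  exact: K33_parallelogram K s2 dd e1 gg out.
Qed.

Lemma K33_concentric q0 q1 q2 Q0 Q1 Q2 :
  moving_K33 q0 q1 q2 Q0 Q1 Q2 -> concentric3 P0 P1 P2 Q0 Q1 Q2.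
Proof.
move=> K; have [j0 j1 j2 dn] := K.
have [[s01 d01]|n01] := pselect (s Q0 = s Q1 /\ d Q0 ^+ 2 = d Q1 ^+ 2).
  exact: K33_equal_pair K (esym s01) (esym d01).
have [[s02 d02]|n02] := pselect (s Q0 = s Q2 /\ d Q0 ^+ 2 = d Q2 ^+ 2).
  apply: concentric3_swap12.
  exact: K33_equal_pair (moving_K33_swap12 K) (esym s02) (esym d02).
have [[s12 d12]|n12] := pselect (s Q1 = s Q2 /\ d Q1 ^+ 2 = d Q2 ^+ 2).
  apply: concentric3_swap01; apply: concentric3_swap12.
  exact: K33_equal_pair (moving_K33_swap12 (moving_K33_swap01 K)) (esym s12) (esym d12).
by case: (no_distinct_heights cc0 cn0 base (ds j0) (ds j1) (lab K) (noncol K) n01 n02 n12).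
Qed.

End K33.

(** * Germs of flexes and rigidity *)

Lemma sqd_eq0 (R : realType) (x y : plane R) : sqd x y = 0 -> x = y.
Proof.
move=> h; apply/eqP; rewrite -subr_eq0; apply/negPn/negP => /dotpp_gt0.
by rewrite -/(sqd x y) h ltxx.
Qed.

Lemma sqd_gt0 (R : realType) (x y : plane R) : x <> y -> 0 < sqd x y.
Proof. by move=> xy; apply: dotpp_gt0; rewrite subr_eq0; apply/eqP. Qed.

Lemma sqdC (R : realType) (x y : plane R) : sqd x y = sqd y x.
Proof. by rewrite /sqd /dotp /=; ring. Qed.

Lemma sqdE (R : realType) (x y : plane R) : sqd x y = eucl_dist x y ^+ 2.
Proof.
rewrite /eucl_dist sqr_sqrtr //; have [->|/eqP/sqd_gt0/ltW//] := eqVneq x y.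
by rewrite subrr /dotp /= mul0r addr0.
Qed.

Lemma cvg_neq_plane (R : realType) (T : Type) (F : set_system T)
    (x : T -> plane R) (X Y : plane R) :
  ProperFilter F -> x @ F --> X -> X <> Y -> \forall t \near F, x t <> Y.
Proof.
move=> FF xX XY.
have h : (fun t => sqd (x t) Y) @ F --> sqd X Y by apply: cvg_sqd => //; exact: cvg_cst.
apply: filterS (cvg_neq _ h (lt0r_neq0 (sqd_gt0 XY))) => t + xY.
by rewrite xY /sqd subrr /dotp /= mul0r addr0 eqxx.
Qed.

(** The framework may rest for a while, so the limit is taken at the infimum [t0] of the times at
    which some joint is displaced. At [t0] all joints are still in place, and displaced times
    accumulate there. *)
Lemma departure_ultrafilter (R : realType) (I : Type) (f : I -> R -> plane R) :
  (forall i, {within `[0, 1], continuous (f i)}) ->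
  (exists2 t : R, t \in `[0, 1] & exists i, f i t <> f i 0) ->
  exists F : set_system R, [/\ UltraFilter F, forall i, f i @ F --> f i 0,
    \forall t \near F, t \in `[0, 1] & \forall t \near F, exists i, f i t <> f i 0].
Proof.
move=> fc [t1 t1I [i1 ft1]].
have {}fc i (x : R) : x \in `[0, 1] -> f i @ within `[0, 1]%classic (nbhs x) --> f i x.
  by move=> xI; have /subspace_continuousP := fc i; apply.
pose A : set R := [set t | t \in `[0, 1] /\ exists i, f i t <> f i 0].
have A0 : A !=set0 by exists t1; split=> //; exists i1.
have lA : lbound A 0 by move=> t [+ _]; rewrite in_itv => /andP[].
pose t0 := inf A.
have hlA : has_lbound A by exists 0.
have t00 : 0 <= t0 by exact: lb_le_inf.
have t0le t : A t -> t0 <= t by exact: ge_inf.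
have t0I : t0 \in `[0, 1].
  rewrite in_itv /= t00 /=; apply: le_trans (t0le t1 _) _; first by split=> //; exists i1.
  by move: t1I; rewrite in_itv => /andP[].
have ft0 i : f i t0 = f i 0.
  apply: contrapT => fi.
  have t0n : 0 < t0.
    by rewrite lt_neqAle t00 andbT eq_sym; apply/eqP => t0E; apply: fi; rewrite t0E.
  have cl : closure (`[0, 1]%classic : set R) t0 by apply: subset_closure.
  have FP : ProperFilter (within (`[0, 1]%classic : set R) (nbhs t0)) by exact: within_nbhs_proper.
  have := cvg_neq_plane FP (fc i t0 t0I) fi.
  rewrite near_withinE => /nbhs_ballP[e /= e0 he].
  (* A time before [t0], cut off at 0 to remain in the interval, at which the joint [i] would
     already be displaced. *)
  pose t := Num.max 0 (t0 - e / 2).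
  have tt0 : t < t0 by rewrite /t gt_max t0n /= ltrBlDr ltrDl divr_gt0.
  have tI : t \in `[0, 1].
    rewrite in_itv /= /t le_max lexx /=; move: t0I tt0; rewrite in_itv /= => /andP[_ h] h'.
    exact: le_trans (ltW h') h.
  have : A t.
    split=> //; exists i; apply: he => //.
    rewrite /ball /= ger0_norm ?subr_ge0 ?ltW // ltrBlDr -ltrBlDl.
    by rewrite /t lt_max; apply/orP; right; lra.
  by move=> /t0le; rewrite leNgt tt0.
have clA : closure A t0.
  move=> B /nbhs_ballP[e /= e0 he].
  have [t At te] := inf_adherent e0 (conj A0 hlA).
  exists t; split=> //; apply: he; rewrite /ball /= distrC ger0_norm ?subr_ge0 ?t0le //.
  by rewrite ltrBlDl.
have FP : ProperFilter (within A (nbhs t0)) by exact: within_nbhs_proper.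
have [F [FU FA]] := ultraFilterLemma FP.
exists F; split=> //.
- move=> i; rewrite -ft0; apply: cvg_trans (fc i t0 t0I) => U /= h.
  apply: FA.
  have {}h : nbhs t0 [set t : R | t \in `[0, 1] -> U (f i t)] by exact: h.
  by apply: (filterS _ h) => t ht [tI _]; exact: ht.
- by apply: FA; apply: (filterE (F := nbhs t0)) => t [].
- by apply: FA; apply: (filterE (F := nbhs t0)) => t [].
Qed.

Definition flex_germ (R : realType) (T : Type) (F : set_system T) (m n : nat)
    (p : 'I_m -> plane R) (q : 'I_n -> plane R)
    (pt : T -> 'I_m -> plane R) (qt : T -> 'I_n -> plane R) : Prop :=
  [/\ (forall i, pt ^~ i @ F --> p i) /\ (forall j, qt ^~ j @ F --> q j),
    \forall t \near F, forall i j, sqd (pt t i) (qt t j) = sqd (p i) (q j),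
    exists i j, p i <> q j /\ \forall t \near F, pt t i = p i /\ qt t j = q j &
    \forall t \near F, (exists i, pt t i <> p i) \/ (exists j, qt t j <> q j)].

Lemma flex_germ_sym (R : realType) (T : Type) (F : set_system T) {FF : Filter F}
    (m n : nat) (p : 'I_m -> plane R) (q : 'I_n -> plane R) pt qt :
  flex_germ F p q pt qt -> flex_germ F q p qt pt.
Proof.
move=> [[cp cq] d [i [j [ij fx]]] mv]; split=> //.
- by apply: filterS d => t h i' j'; rewrite sqdC h sqdC.
- exists j, i; split; first by move=> /esym.
  by apply: filterS fx => t [].
- by apply: filterS mv => t []; [right|left].
Qed.

Lemma flex_germ_of_flex (R : realType) (m n : nat)
    (p : 'I_m -> plane R) (q : 'I_n -> plane R) :
  framework p q -> flexible p q -> exists F : set_system R,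
    UltraFilter F /\ exists pt qt, flex_germ F p q pt qt.
Proof.
move=> fr [pt [qt [[cp cq] [s [t [sI tI st]]] [p0 q0] dist [i0 [j0 fx]]]]].
pose f (k : 'I_m + 'I_n) (t : R) := match k with inl i => pt t i | inr j => qt t j end.
have fc k : {within `[0, 1], continuous (f k)} by case: k.
have [|F [FU Fc FI Fm]] := departure_ultrafilter fc.
  apply: contrapT => nm.
  have h x k : x \in `[0, 1] -> f k x = f k 0.
    by move=> xI; apply: contrapT => fk; apply: nm; exists x => //; exists k.
  case: st => [[i]|[j]]; apply.
    by have /= -> := h s (inl i) sI; have /= -> := h t (inl i) tI.
  by have /= -> := h s (inr j) sI; have /= -> := h t (inr j) tI.
have I0 : (0 : R) \in `[0, 1] by rewrite in_itv /= lexx ler01.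
exists F; split=> //; exists pt, qt; split.
- split=> [i|j]; first by rewrite -p0; exact: (Fc (inl i)).
  by rewrite -q0; exact: (Fc (inr j)).
- apply: filterS FI => x xI i j.
  by rewrite !sqdE -p0 -q0 (dist i j x 0 xI I0).
- exists i0, j0; split; first exact: fr.
  by apply: filterS FI => x xI; exact: fx.
- apply: filterS Fm => x [[i|j] h]; [left; exists i|right; exists j];
    by rewrite -?p0 -?q0.
Qed.

(** * Configurations that only a rigid motion could preserve *)

Section Rigidity.
Context (R : realType) (T : Type) (F : set_system T) {FU : UltraFilter F}.
Context (m n : nat) (p : 'I_m -> plane R) (q : 'I_n -> plane R).
Context (pt : T -> 'I_m -> plane R) (qt : T -> 'I_n -> plane R).
Hypothesis germ : flex_germ F p q pt qt.
Context (k0 k1 : 'I_m).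
Hypothesis k01 : p k0 <> p k1.

Let w t x : R * R := (dotp (pt t k1 - pt t k0) (x - pt t k0),
  crossp (pt t k1 - pt t k0) (x - pt t k0)).
Let w0 x : R * R := (dotp (p k1 - p k0) (x - p k0),
  crossp (p k1 - p k0) (x - p k0)).

(** Constant coordinates in the moving frame mean an orientation-preserving isometry. It fixes both
    ends of a rod, hence every joint, whereas some joint has moved. *)
Lemma flex_germ_not_congruent :
  (\forall t \near F, forall i, w t (pt t i) = w0 (p i)) ->
  (\forall t \near F, forall j, w t (qt t j) = w0 (q j)) -> False.
Proof.
move=> hp hq; have [_ _ [i0 [j0 [ij fx]]] mv] := germ.
apply: (@filter_const _ F).
suff h : \forall t \near F, (forall i, pt t i = p i) /\ (forall j, qt t j = q j).
  by apply: filterS2 h mv => t [hpt hqt] [[i]|[j]]; rewrite ?hpt ?hqt; apply.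
apply: filterS3 hp hq fx => t hpt hqt [pi qj].
have [a1 a2] := hpt i0; have [b1 b2] := hqt j0; have [c1 c2] := hpt k1.
rewrite pi in a1 a2; rewrite qj in b1 b2.
set u := pt t k1 - pt t k0 in a1 a2 b1 b2 c1 c2.
set u0 := p k1 - p k0 in a1 a2 b1 b2 c1 c2.
set o := pt t k0 in u a1 a2 b1 b2 c1 c2.
set o0 := p k0 in u0 a1 a2 b1 b2 c1 c2.
pose y := p i0 - q j0.
have y0 : 0 < dotp y y by exact: sqd_gt0.
have yd : dotp u y = dotp u0 y.
  transitivity (dotp u (p i0 - o) - dotp u (q j0 - o)); first by rewrite /dotp /y /=; ring.
  by rewrite a1 b1 /dotp /y /=; ring.
have yc : crossp u y = crossp u0 y.
  transitivity (crossp u (p i0 - o) - crossp u (q j0 - o)).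
    by rewrite /crossp /y /=; ring.
  by rewrite a2 b2 /crossp /y /=; ring.
have uE : u = u0.
  rewrite [u]surjective_pairing [u0]surjective_pairing; congr pair;
    apply: (mulfI (lt0r_neq0 y0)).
    transitivity (dotp u y * y.1 + crossp u y * y.2); first by rewrite /dotp /crossp; ring.
    by rewrite yd yc /dotp /crossp; ring.
  transitivity (dotp u y * y.2 - crossp u y * y.1); first by rewrite /dotp /crossp; ring.
  by rewrite yd yc /dotp /crossp; ring.
have u0n : 0 < dotp u0 u0 by apply: sqd_gt0 => h; exact: k01.
have key x x0 : w t x = w0 x0 -> x - o = x0 - o0.
  move=> [h1 h2]; rewrite -/u -/u0 -/o -/o0 uE in h1 h2.
  rewrite [LHS]surjective_pairing [RHS]surjective_pairing; congr pair;
    apply: (mulfI (lt0r_neq0 u0n)).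
    transitivity (dotp u0 (x - o) * u0.1 - crossp u0 (x - o) * u0.2).
      by rewrite /dotp /crossp; ring.
    by rewrite h1 h2 /dotp /crossp; ring.
  transitivity (dotp u0 (x - o) * u0.2 + crossp u0 (x - o) * u0.1).
    by rewrite /dotp /crossp; ring.
  by rewrite h1 h2 /dotp /crossp; ring.
have oE : o = o0.
  have := key _ _ (hpt i0); rewrite pi => h.
  by rewrite -(subKr (p i0) o) h subKr.
by split=> [i|j]; [have := key _ _ (hpt i)|have := key _ _ (hqt j)];
  rewrite oE => /addIr.
Qed.

(** Each triangle formed by the two joints and some q_j keeps its sides, hence the square of its
    signed area; convergence to the initial position fixes the sign. *)
Lemma flex_germ_opposite_part :
  (\forall t \near F, sqd (pt t k1) (pt t k0) = sqd (p k1) (p k0)) ->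
  \forall t \near F, forall j, w t (qt t j) = w0 (q j).
Proof.
move=> hc; have [[cp cq] hd _ _] := germ.
apply: filter_forall => j.
pose cr t := crossp (pt t k1 - pt t k0) (qt t j - pt t k0).
have ccr : cr @ F --> (w0 (q j)).2 by apply: cvg_crossp; apply: cvgB.
have h1 : \forall t \near F, (w t (qt t j)).1 = (w0 (q j)).1 /\
    ((cr t = (w0 (q j)).2) \/ cr t = - (w0 (q j)).2).
  apply: filterS2 hd hc => t d cE.
  have dE x y z : dotp (y - x) (z - x) = (sqd y x + sqd x z - sqd y z) / 2 :> R.
    by rewrite /sqd /dotp /=; field.
  have e1 : (w t (qt t j)).1 = (w0 (q j)).1 by rewrite /= !dE cE !d.
  split=> //.
  have Lag x y z : crossp (y - x) (z - x) ^+ 2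
     = sqd y x * sqd x z - dotp (y - x) (z - x) ^+ 2 :> R.
    by rewrite /sqd /dotp /crossp /=; ring.
  have : cr t ^+ 2 = (w0 (q j)).2 ^+ 2.
    by rewrite /cr /= !Lag cE !d; congr (_ - _ ^+ 2); exact: e1.
  by move/eqP; rewrite eqf_sqr => /orP[] /eqP; [left|right].
have h2 : \forall t \near F, cr t = (w0 (q j)).2.
  have [z|nz] := eqVneq (w0 (q j)).2 0.
    by apply: filterS h1 => t [_]; rewrite z oppr0 => -[].
  have nz' : (w0 (q j)).2 != - (w0 (q j)).2 by rewrite -addr_eq0 -mulr2n mulrn_eq0.
  apply: filterS2 h1 (cvg_neq _ ccr nz') => t [_ []] // -> /eqP //.
apply: filterS2 h1 h2 => t [e1 _] e2.
by rewrite [LHS]surjective_pairing [RHS]surjective_pairing e1 -e2.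
Qed.

(** By polarisation this scalar product involves only the four rods between the two pairs of
    joints. *)
Lemma germ_dotp t :
  (forall i j, sqd (pt t i) (qt t j) = sqd (p i) (q j)) ->
  forall i i' j j', dotp (pt t i - pt t i') (qt t j - qt t j')
    = dotp (p i - p i') (q j - q j').
Proof.
have dE (a b c d : plane R) : dotp (a - b) (c - d) =
    (sqd a d + sqd b c - sqd a c - sqd b d) / 2.
  by rewrite /sqd /dotp /=; field.
by move=> h i i' j j'; rewrite !dE !h.
Qed.

(** If the distance stayed constant, the q_j would be rigid relative to the pair. Preserved scalar
    products with two independent differences of the q_j would then fix every p_i, and the motion
    would be a congruence. *)
Lemma flex_germ_moving_pair (j0 j1 j2 : 'I_n) :
  crossp (q j1 - q j0) (q j2 - q j0) != 0 ->
  \forall t \near F, sqd (pt t k1) (pt t k0) != sqd (p k1) (p k0).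
Proof.
move=> qn; have [//|h] := in_ultra_setVsetC
  [set t | sqd (pt t k1) (pt t k0) != sqd (p k1) (p k0)] FU.
exfalso.
have hc : \forall t \near F, sqd (pt t k1) (pt t k0) = sqd (p k1) (p k0).
  by apply: filterS h => t /= /negP; rewrite negbK => /eqP.
have hq := flex_germ_opposite_part hc.
apply: (flex_germ_not_congruent _ hq).
have [_ hd _ _] := germ.
apply: filterS3 hd hc hq => t d cE hqt i.
have u0n : 0 < dotp (p k1 - p k0) (p k1 - p k0) by apply: sqd_gt0 => h'; exact: k01.
set u := pt t k1 - pt t k0; set u0 := p k1 - p k0 in u0n *.
have cE' : dotp u u = dotp u0 u0 by exact: cE.
have yE j j' : dotp u (qt t j - qt t j') = dotp u0 (q j - q j') /\
    crossp u (qt t j - qt t j') = crossp u0 (q j - q j').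
  have [a1 a2] := hqt j; have [b1 b2] := hqt j'.
  rewrite -/u -/u0 in a1 a2 b1 b2; split.
    transitivity (dotp u (qt t j - pt t k0) - dotp u (qt t j' - pt t k0)).
      by rewrite /dotp /=; ring.
    by rewrite a1 b1 /dotp /=; ring.
  transitivity (crossp u (qt t j - pt t k0) - crossp u (qt t j' - pt t k0)).
    by rewrite /crossp /=; ring.
  by rewrite a2 b2 /crossp /=; ring.
have [a1 b1] := yE j1 j0; have [a2 b2] := yE j2 j0.
have d1 := germ_dotp d i k0 j1 j0; have d2 := germ_dotp d i k0 j2 j0.
set x := pt t i - pt t k0 in d1 d2; set x0 := p i - p k0 in d1 d2.
rewrite /w /w0 -/u -/u0 -/x -/x0.
have split_dot (u' v y : plane R) : dotp u' u' * dotp v y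
    = dotp u' v * dotp u' y + crossp u' v * crossp u' y.
  by rewrite /dotp /crossp; ring.
set y1 := q j1 - q j0 in qn a1 b1 d1; set y2 := q j2 - q j0 in qn a2 b2 d2.
(* [e1] and [e2] form a linear system for the change of the coordinates of the joint [i]; its
   determinant is a nonzero multiple of [crossp y1 y2]. *)
have e1 : (dotp u x - dotp u0 x0) * dotp u0 y1
    + (crossp u x - crossp u0 x0) * crossp u0 y1 = 0.
  transitivity (dotp u x * dotp u0 y1 + crossp u x * crossp u0 y1
     - (dotp u0 x0 * dotp u0 y1 + crossp u0 x0 * crossp u0 y1)); first by ring.
  by rewrite -split_dot -a1 -b1 -split_dot cE' d1 subrr.
have e2 : (dotp u x - dotp u0 x0) * dotp u0 y2
    + (crossp u x - crossp u0 x0) * crossp u0 y2 = 0.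
  transitivity (dotp u x * dotp u0 y2 + crossp u x * crossp u0 y2
     - (dotp u0 x0 * dotp u0 y2 + crossp u0 x0 * crossp u0 y2)); first by ring.
  by rewrite -split_dot -a2 -b2 -split_dot cE' d2 subrr.
have detE : dotp u0 y1 * crossp u0 y2 - dotp u0 y2 * crossp u0 y1 =
   dotp u0 u0 * crossp y1 y2 by rewrite /dotp /crossp; ring.
have detn : dotp u0 y1 * crossp u0 y2 - dotp u0 y2 * crossp u0 y1 != 0.
  by rewrite detE mulf_neq0 // lt0r_neq0.
congr pair; apply/subr0_eq; apply: (mulIf detn); rewrite mul0r.
  transitivity (((dotp u x - dotp u0 x0) * dotp u0 y1
    + (crossp u x - crossp u0 x0) * crossp u0 y1) * crossp u0 y2
   - ((dotp u x - dotp u0 x0) * dotp u0 y2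
    + (crossp u x - crossp u0 x0) * crossp u0 y2) * crossp u0 y1); first by ring.
  by rewrite e1 e2; ring.
transitivity (((dotp u x - dotp u0 x0) * dotp u0 y2
    + (crossp u x - crossp u0 x0) * crossp u0 y2) * dotp u0 y1
   - ((dotp u x - dotp u0 x0) * dotp u0 y1
    + (crossp u x - crossp u0 x0) * crossp u0 y1) * dotp u0 y2); first by ring.
by rewrite e1 e2; ring.
Qed.

(** By Stewart's theorem the rods from [j] determine [s ^+ 2 - s] times the squared distance of the
    two base joints. The factor is nonzero for the third point [k2], so this distance is constant
    and the motion a congruence. *)
Lemma flex_germ_not_affine_line (s : 'I_m -> R) (k2 : 'I_m) (j : 'I_n) :
  (forall i, p i - p k0 = s i *: (p k1 - p k0)) -> p k2 <> p k0 -> p k2 <> p k1 ->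
  ~ \forall t \near F, forall i, pt t i - pt t k0 = s i *: (pt t k1 - pt t k0).
Proof.
move=> hs k20 k21 hst; have [_ hd _ _] := germ.
have hc : \forall t \near F, sqd (pt t k1) (pt t k0) = sqd (p k1) (p k0).
  apply: filterS2 hd hst => t d st.
  have St (x y z v : plane R) (a : R) : z - x = a *: (y - x) ->
      (a ^+ 2 - a) * sqd y x = sqd z v - sqd x v - a * (sqd y v - sqd x v).
    move=> h; have h1 : z.1 - x.1 = a * (y.1 - x.1) := congr1 fst h.
    have h2 : z.2 - x.2 = a * (y.2 - x.2) := congr1 snd h.
    have -> : z = (x.1 + a * (y.1 - x.1), x.2 + a * (y.2 - x.2)).
      by rewrite [z]surjective_pairing; congr pair; [rewrite -h1|rewrite -h2]; rewrite /=; ring.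
    by rewrite /sqd /dotp /=; ring.
  have an : s k2 ^+ 2 - s k2 != 0.
    rewrite (_ : _ - _ = s k2 * (s k2 - 1)); last by ring.
    rewrite mulf_neq0 //.
      apply: contra_notN k20 => /eqP s0; have := hs k2.
      by rewrite s0 scale0r => /subr0_eq.
    rewrite subr_eq0; apply: contra_notN k21 => /eqP s1; have := hs k2.
    by rewrite s1 scale1r => /addIr.
  apply: (mulfI an).
  by rewrite (St _ _ _ (qt t j) _ (st k2)) (St _ _ _ (q j) _ (hs k2)) !d.
apply: (flex_germ_not_congruent _ (flex_germ_opposite_part hc)).
apply: filterS2 hst hc => t st cE i.
have wE x y z a : z - x = a *: (y - x) ->
   (dotp (y - x) (z - x), crossp (y - x) (z - x)) = (a * sqd y x, 0) :> plane R.
  by move=> ->; rewrite /sqd /dotp /crossp /= -![a *: _]/(a * _); congr pair; ring.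
by rewrite /w /w0 (wE _ _ _ _ (st i)) (wE _ _ _ _ (hs i)) cE.
Qed.

End Rigidity.

Lemma crossp0_scale (R : realType) (u v : plane R) :
  u != 0 -> crossp u v = 0 -> v = (dotp u v / dotp u u) *: u.
Proof.
move=> /dotpp_gt0/lt0r_neq0 un uv.
have e1 : v.1 = dotp u v / dotp u u * u.1.
  apply: (mulIf un); rewrite mulrAC divfK //.
  by transitivity (dotp u v * u.1 - crossp u v * u.2);
    [rewrite /dotp /crossp; ring|rewrite uv; ring].
have e2 : v.2 = dotp u v / dotp u u * u.2.
  apply: (mulIf un); rewrite mulrAC divfK //.
  by transitivity (dotp u v * u.2 + crossp u v * u.1);
    [rewrite /dotp /crossp; ring|rewrite uv; ring].
by rewrite [LHS]surjective_pairing e1 e2.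
Qed.

Lemma dotp_subZl (R : realType) (a : R) (x y z : plane R) :
  dotp (x - a *: y) z = dotp x z - a * dotp y z.
Proof. by rewrite /dotp /= -![a *: _]/(a * _); ring. Qed.

Lemma dotp_eq0_noncollinear (R : realType) (x y z : plane R) :
  crossp y z != 0 -> dotp x y = 0 -> dotp x z = 0 -> x = 0.
Proof.
move=> yz xy xz; rewrite [x]surjective_pairing -[RHS]/(0, 0); congr pair;
  apply: (mulIf yz); rewrite mul0r.
  transitivity (dotp x y * z.2 - dotp x z * y.2); first by rewrite /dotp /crossp; ring.
  by rewrite xy xz; ring.
transitivity (dotp x z * y.1 - dotp x y * z.1); first by rewrite /dotp /crossp; ring.
by rewrite xy xz; ring.
Qed.

Lemma dotp_eq0_parallel (R : realType) (h x y u : plane R) :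
  h <> 0 -> dotp h x = 0 -> dotp h y = 0 -> dotp u y != 0 -> dotp u x = 0 -> x = 0.
Proof.
move=> h0 hx hy uy ux.
have xy : crossp x y = 0.
  apply/eqP/negPn/negP => xy; apply: h0; exact: dotp_eq0_noncollinear xy hx hy.
rewrite [x]surjective_pairing -[RHS]/(0, 0); congr pair;
  apply: (mulIf uy); rewrite mul0r.
  transitivity (dotp u x * y.1 + u.2 * crossp x y); first by rewrite /dotp /crossp; ring.
  by rewrite xy ux; ring.
transitivity (dotp u x * y.2 - u.1 * crossp x y); first by rewrite /dotp /crossp; ring.
by rewrite xy ux; ring.
Qed.

(** * Frameworks with one part on a line *)

Section Collinear.
Context (R : realType) (T : Type) (F : set_system T) {FU : UltraFilter F}.
Context (m n : nat) (p : 'I_m -> plane R) (q : 'I_n -> plane R).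
Context (pt : T -> 'I_m -> plane R) (qt : T -> 'I_n -> plane R).
Hypothesis germ : flex_germ F p q pt qt.
Context (k0 k1 k2 : 'I_m).
Hypothesis inj_p : [/\ p k0 <> p k1, p k2 <> p k0 & p k2 <> p k1].
Hypothesis line_p : forall i, crossp (p k1 - p k0) (p i - p k0) = 0.

Let s i := dotp (p k1 - p k0) (p i - p k0) / dotp (p k1 - p k0) (p k1 - p k0).

Let p_s i : p i - p k0 = s i *: (p k1 - p k0).
Proof.
apply: crossp0_scale => //; rewrite subr_eq0; apply/eqP => h.
by case: inj_p; rewrite h.
Qed.

(** The failure of joint [i] to keep its affine position on the line. Since scalar products of
    differences are preserved, it is orthogonal to all differences of the q_j. *)
Let hat t i : plane R := (pt t i - pt t k0) - s i *: (pt t k1 - pt t k0).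

Let dotp_hat t : (forall i j, sqd (pt t i) (qt t j) = sqd (p i) (q j)) ->
  forall i j j', dotp (hat t i) (qt t j - qt t j') = 0.
Proof.
move=> d i j j'; rewrite dotp_subZl !(germ_dotp d) -dotp_subZl p_s subrr.
by rewrite /dotp /= !mul0r addr0.
Qed.

Lemma flex_germ_line_noncollinear (j0 j1 j2 : 'I_n) :
  crossp (q j1 - q j0) (q j2 - q j0) != 0 -> False.
Proof.
move=> qn; have [[_ cq] hd _ _] := germ; have [k01 k20 k21] := inj_p.
apply: (flex_germ_not_affine_line germ k01 j0 p_s k20 k21).
have cc : (fun t => crossp (qt t j1 - qt t j0) (qt t j2 - qt t j0)) @ F -->
    crossp (q j1 - q j0) (q j2 - q j0) by apply: cvg_crossp; apply: cvgB.
apply: filterS2 hd (cvg_neq _ cc qn) => t d qn' i.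
by apply/subr0_eq; exact: dotp_eq0_noncollinear qn' (dotp_hat d i _ _) (dotp_hat d i _ _).
Qed.

(** A nonzero [hat] forces all differences of the q_j to be parallel. Their preserved scalar
    products with the difference of [k1] and [k0], nonzero for the base pair by the last hypothesis,
    then fix the ratios. *)
Lemma flex_germ_line_dichotomy (l0 l1 : 'I_n) :
  (forall j, crossp (q l1 - q l0) (q j - q l0) = 0) ->
  dotp (p k1 - p k0) (q l1 - q l0) != 0 ->
  \forall t \near F, (forall i, pt t i - pt t k0 = s i *: (pt t k1 - pt t k0)) \/
   (forall j, qt t j - qt t l0 =
     (dotp (q l1 - q l0) (q j - q l0) / dotp (q l1 - q l0) (q l1 - q l0)) *:
       (qt t l1 - qt t l0)).
Proof.
move=> line_q uv; have [_ hd _ _] := germ; apply: filterS hd => t d.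
have [h|nh] := pselect (forall i, hat t i = 0).
  by left=> i; apply/subr0_eq; exact: h.
right=> j; have /existsNP[i hi] := nh; apply/subr0_eq.
have v0 : q l1 - q l0 != 0.
  by apply: contra uv => /eqP ->; rewrite /dotp /= !mulr0 addr0.
have dC (x y : plane R) : dotp x y = dotp y x by rewrite /dotp; ring.
apply: (dotp_eq0_parallel (h := hat t i) (y := qt t l1 - qt t l0)
  (u := pt t k1 - pt t k0)) => //.
- by rewrite dC dotp_subZl 2!(dC _ (hat t i)) !(dotp_hat d) mulr0 subrr.
- exact: dotp_hat.
- by rewrite (germ_dotp d).
- rewrite dC dotp_subZl !(dC _ (pt t k1 - pt t k0)) !(germ_dotp d).
  rewrite !(dC (p k1 - p k0)) -dotp_subZl {1}(crossp0_scale v0 (line_q j)) subrr.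
  by rewrite /dotp /= !mul0r addr0.
Qed.

End Collinear.

Lemma flex_germ_two_lines (R : realType) (T : Type) (F : set_system T)
    {FU : UltraFilter F} (m n : nat)
    (p : 'I_m -> plane R) (q : 'I_n -> plane R) pt qt
    (k0 k1 k2 : 'I_m) (l0 l1 l2 : 'I_n) :
  flex_germ F p q pt qt ->
  [/\ p k0 <> p k1, p k2 <> p k0 & p k2 <> p k1] ->
  [/\ q l0 <> q l1, q l2 <> q l0 & q l2 <> q l1] ->
  (forall i, crossp (p k1 - p k0) (p i - p k0) = 0) ->
  (forall j, crossp (q l1 - q l0) (q j - q l0) = 0) ->
  dotp (p k1 - p k0) (q l1 - q l0) = 0.
Proof.
move=> germ hp hq lp lq; apply/eqP/negPn/negP => uv.
have [k01 k20 k21] := hp; have [l01 l20 l21] := hq.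
have u0 : p k1 - p k0 != 0 by rewrite subr_eq0; apply/eqP => /esym.
have v0 : q l1 - q l0 != 0 by rewrite subr_eq0; apply/eqP => /esym.
case: (ultra_or FU (flex_germ_line_dichotomy germ hp lp lq uv)) => hst.
  apply: (flex_germ_not_affine_line germ k01 l0 _ k20 k21 hst) => i.
  exact: crossp0_scale.
apply: (flex_germ_not_affine_line (flex_germ_sym germ) l01 k0 _ l20 l21 hst) => j.
exact: crossp0_scale.
Qed.

(** * Uniqueness of a rectangle with three given vertices *)

Section Extension.
Context (R : realType).

Lemma rect_verticesE (a b : R) (x : plane R) :
  rect_vertices a b x <-> x.1 ^+ 2 = a ^+ 2 /\ x.2 ^+ 2 = b ^+ 2.
Proof.
have key (c d : R) : (c = d \/ c = - d) <-> c ^+ 2 = d ^+ 2.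
  split=> [[->|->]|/eqP]; [by []|by rewrite sqrrN|].
  by rewrite eqf_sqr => /orP[] /eqP; [left|right].
by rewrite /rect_vertices /=; split=> -[] /key h1 /key h2.
Qed.

Lemma frame_parseval (e1 e2 x : plane R) : orthonormal_frame e1 e2 ->
  dotp x e1 ^+ 2 + dotp x e2 ^+ 2 = dotp x x.
Proof.
move=> [h1 h2 h3].
have h4 : crossp e1 e2 ^+ 2 = 1.
  transitivity (dotp e1 e1 * dotp e2 e2 - dotp e1 e2 ^+ 2).
    by rewrite /dotp /crossp; ring.
  by rewrite h1 h2 h3; ring.
have h5 : e1.1 ^+ 2 + e2.1 ^+ 2 = 1.
  transitivity (e1.1 ^+ 2 * dotp e2 e2 + e2.1 ^+ 2 * dotp e1 e1); first by rewrite h1 h2; ring.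
  transitivity (crossp e1 e2 ^+ 2 + 2 * (e1.1 * e2.1) * dotp e1 e2).
    by rewrite /dotp /crossp; ring.
  by rewrite h3 h4; ring.
have h6 : e1.2 ^+ 2 + e2.2 ^+ 2 = 1.
  have -> : e1.2 ^+ 2 + e2.2 ^+ 2 = dotp e1 e1 + dotp e2 e2 - (e1.1 ^+ 2 + e2.1 ^+ 2).
    by rewrite /dotp; ring.
  by rewrite h1 h2 h5; ring.
have h7 : e1.1 * e1.2 + e2.1 * e2.2 = 0.
  transitivity ((e1.1 * e1.2) * dotp e2 e2 + (e2.1 * e2.2) * dotp e1 e1).
    by rewrite h1 h2; ring.
  transitivity ((e1.1 * e2.2 + e1.2 * e2.1) * dotp e1 e2); first by rewrite /dotp; ring.
  by rewrite h3 mulr0.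
transitivity (x.1 ^+ 2 * (e1.1 ^+ 2 + e2.1 ^+ 2) + x.2 ^+ 2 * (e1.2 ^+ 2 + e2.2 ^+ 2)
  + 2 * x.1 * x.2 * (e1.1 * e1.2 + e2.1 * e2.2)); first by rewrite /dotp; ring.
by rewrite h5 h6 h7 /dotp; ring.
Qed.

Lemma frame_expand (e1 e2 x y : plane R) : orthonormal_frame e1 e2 ->
  dotp x y = dotp x e1 * dotp y e1 + dotp x e2 * dotp y e2.
Proof.
move=> fr; have h z := frame_parseval z fr.
have := h (x + y); have := h (x - y).
have -> : dotp (x + y) (x + y) = dotp x x + dotp y y + 2 * dotp x y.
  by rewrite /dotp /=; ring.
have -> : dotp (x - y) (x - y) = dotp x x + dotp y y - 2 * dotp x y.
  by rewrite /dotp /=; ring.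
have a e : dotp (x + y) e = dotp x e + dotp y e by rewrite /dotp /=; ring.
have b e : dotp (x - y) e = dotp x e - dotp y e by rewrite /dotp /=; ring.
rewrite !a !b => h1 h2; lra.
Qed.

(** The centre is the circumcentre of the three vertices. *)
Lemma rect3_center (o e1 e2 o' e1' e2' : plane R) (a b a' b' : R)
    (x0 x1 x2 : plane R) :
  orthonormal_frame e1 e2 -> orthonormal_frame e1' e2' ->
  crossp (x1 - x0) (x2 - x0) != 0 ->
  rect3 o e1 e2 a b x0 x1 x2 -> rect3 o' e1' e2' a' b' x0 x1 x2 -> o = o'.
Proof.
move=> fr fr' xn [/rect_verticesE[a0 b0] /rect_verticesE[a1 b1] /rect_verticesE[a2 b2]].
move=> [/rect_verticesE[a0' b0'] /rect_verticesE[a1' b1'] /rect_verticesE[a2' b2']].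
have r (x : plane R) : (coords o e1 e2 x).1 ^+ 2 = a ^+ 2 ->
    (coords o e1 e2 x).2 ^+ 2 = b ^+ 2 -> sqd x o = a ^+ 2 + b ^+ 2.
  by move=> /= h1 h2; rewrite /sqd -(frame_parseval _ fr) h1 h2.
have r' (x : plane R) : (coords o' e1' e2' x).1 ^+ 2 = a' ^+ 2 ->
    (coords o' e1' e2' x).2 ^+ 2 = b' ^+ 2 -> sqd x o' = a' ^+ 2 + b' ^+ 2.
  by move=> /= h1 h2; rewrite /sqd -(frame_parseval _ fr') h1 h2.
have key x y : sqd x o = sqd y o -> sqd x o' = sqd y o' -> dotp (o - o') (x - y) = 0.
  move=> h1 h2; apply: (@mulfI _ 2); rewrite ?pnatr_eq0 // mulr0.
  transitivity (sqd x o' - sqd y o' - (sqd x o - sqd y o)); first by rewrite /sqd /dotp /=; ring.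
  by rewrite h1 h2 !subrr.
apply/subr0_eq; apply: (dotp_eq0_noncollinear xn); apply: key; rewrite ?r ?r' //.
Qed.

(** For mirror images [x] and [y] the squared coordinates along [e1'] differ by a mixed term, which
    vanishes only if [e1'] lies along an old axis. *)
Lemma rect_pair_frame (e1 e2 e1' e2' x y : plane R) :
  orthonormal_frame e1 e2 -> orthonormal_frame e1' e2' ->
  dotp x e1 = dotp y e1 -> dotp x e2 = - dotp y e2 ->
  dotp x e1 != 0 -> dotp x e2 != 0 ->
  dotp x e1' ^+ 2 = dotp y e1' ^+ 2 -> dotp e1' e1 * dotp e1' e2 = 0.
Proof.
move=> fr fr' h1 h2 n1 n2 h.
apply: (mulfI (mulf_neq0 n1 n2)); rewrite mulr0.
apply: (@mulfI _ 4); rewrite ?pnatr_eq0 // mulr0.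
move: h; rewrite (frame_expand x e1' fr) (frame_expand y e1' fr) h1 h2 => h.
transitivity ((dotp y e1 * dotp e1' e1 - dotp y e2 * dotp e1' e2) ^+ 2 * -1 * -1
  - (dotp y e1 * dotp e1' e1 + dotp y e2 * dotp e1' e2) ^+ 2); first by ring.
by move: h; rewrite mulNr => ->; ring.
Qed.

(** Two of three vertices share the first coordinate; being distinct, they are mirror images, and
    [rect_pair_frame] applies to them. *)
Lemma rect3_frame (o e1 e2 o' e1' e2' : plane R) (a b a' b' : R)
    (x0 x1 x2 : plane R) :
  0 < a -> 0 < b ->
  orthonormal_frame e1 e2 -> orthonormal_frame e1' e2' ->
  crossp (x1 - x0) (x2 - x0) != 0 ->
  rect3 o e1 e2 a b x0 x1 x2 -> rect3 o' e1' e2' a' b' x0 x1 x2 ->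
  o = o' /\ dotp e1' e1 * dotp e1' e2 = 0.
Proof.
move=> a0 b0 fr fr' xn h h'; have oE := rect3_center fr fr' xn h h'; split=> //.
rewrite -oE in h'.
have key x y : rect_vertices a b (coords o e1 e2 x) -> rect_vertices a b (coords o e1 e2 y) ->
   rect_vertices a' b' (coords o e1' e2' x) -> rect_vertices a' b' (coords o e1' e2' y) ->
   dotp (x - o) e1 = dotp (y - o) e1 -> x <> y -> dotp e1' e1 * dotp e1' e2 = 0.
  move=> /rect_verticesE[/= xa xb] /rect_verticesE[/= ya yb] /rect_verticesE[/= xa' _]
     /rect_verticesE[/= ya' _] e xy.
  apply: (@rect_pair_frame e1 e2 e1' e2' (x - o) (y - o)) => //.
  - have /eqP := etrans xb (esym yb); rewrite eqf_sqr => /orP[] /eqP // e'.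
    exfalso; apply: xy; apply: sqd_eq0.
    have -> : sqd x y = dotp (x - y) (x - y) by [].
    rewrite -(frame_parseval _ fr).
    have d c : dotp (x - y) c = dotp (x - o) c - dotp (y - o) c by rewrite /dotp /=; ring.
    by rewrite !d e e' !subrr expr0n addr0.
  - by rewrite -sqrf_eq0 xa sqrf_eq0 gt_eqF.
  - by rewrite -sqrf_eq0 xb sqrf_eq0 gt_eqF.
  - by rewrite xa' ya'.
have x01 : x0 <> x1 by move=> e; move: xn; rewrite e subrr /crossp /= !mul0r subrr eqxx.
have x02 : x0 <> x2 by move=> e; move: xn; rewrite e subrr /crossp /= !mulr0 subrr eqxx.
have x12 : x1 <> x2.
  by move=> e; move: xn; rewrite e /crossp mulrC subrr eqxx.
have [h0 h1 h2] := h; have [h0' h1' h2'] := h'.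
have [[/= c0|/= c0] _] := h0; have [[/= c1|/= c1] _] := h1; have [[/= c2|/= c2] _] := h2;
  by [apply: (key x0 x1) => //; rewrite c0 c1|apply: (key x0 x2) => //; rewrite c0 c2
     |apply: (key x1 x2) => //; rewrite c1 c2].
Qed.

Lemma frame_sq_cases (e1 e2 e1' e2' : plane R) :
  orthonormal_frame e1 e2 -> orthonormal_frame e1' e2' ->
  dotp e1' e1 * dotp e1' e2 = 0 ->
  (forall x, dotp x e1' ^+ 2 = dotp x e1 ^+ 2 /\ dotp x e2' ^+ 2 = dotp x e2 ^+ 2) \/
  (forall x, dotp x e1' ^+ 2 = dotp x e2 ^+ 2 /\ dotp x e2' ^+ 2 = dotp x e1 ^+ 2).
Proof.
move=> fr fr' /eqP; have [n1 _ _] := fr'.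
have n := frame_parseval e1' fr.
have p x := frame_parseval x fr; have p' x := frame_parseval x fr'.
rewrite mulf_eq0 => /orP[] /eqP h; [right|left] => x.
  have e : dotp x e1' ^+ 2 = dotp x e2 ^+ 2.
    rewrite (frame_expand x e1' fr) h mulr0 add0r exprMn.
    by move: n; rewrite h n1 expr0n add0r => ->; rewrite mulr1.
  by split=> //; have := p x; have := p' x; rewrite e => h1 h2; lra.
have e : dotp x e1' ^+ 2 = dotp x e1 ^+ 2.
  rewrite (frame_expand x e1' fr) h mulr0 addr0 exprMn.
  by move: n; rewrite h n1 expr0n addr0 => ->; rewrite mulr1.
by split=> //; have := p x; have := p' x; rewrite e => h1 h2; lra.
Qed.

(** The triple [x0], [x1], [x2] identifies the centres and, up to exchange, the axes; the point [z],
    a vertex in both descriptions, identifies the half sides of the other rectangle. *)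
Lemma rect_transfer (o e1 e2 o' e1' e2' : plane R) (a b c d a' b' c' d' : R)
    (x0 x1 x2 y z : plane R) :
  0 < c -> 0 < d -> orthonormal_frame e1 e2 -> orthonormal_frame e1' e2' ->
  crossp (x1 - x0) (x2 - x0) != 0 ->
  rect3 o e1 e2 c d x0 x1 x2 -> rect3 o' e1' e2' c' d' x0 x1 x2 ->
  rect_vertices a b (coords o e1 e2 z) ->
  rect_vertices a' b' (coords o' e1' e2' z) ->
  rect_vertices a' b' (coords o' e1' e2' y) ->
  rect_vertices a b (coords o e1 e2 y).
Proof.
move=> c0 d0 fr fr' xn h h'.
have [<- e] := rect3_frame c0 d0 fr fr' xn h h'.
move=> /rect_verticesE[/= za zb] /rect_verticesE[/= za' zb'] /rect_verticesE[/= ya' yb'].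
apply/rect_verticesE => /=.
have [k|k] := frame_sq_cases fr fr' e.
  have [k1 k2] := k (z - o); have [l1 l2] := k (y - o).
  by rewrite -l1 -l2 ya' yb' -za' -zb' k1 k2.
have [k1 k2] := k (z - o); have [l1 l2] := k (y - o).
by rewrite -l1 -l2 ya' yb' -za' -zb' k1 k2.
Qed.

End Extension.

Lemma crossp_triangle (R : realType) (x p0 p1 p2 : plane R) :
  crossp (p1 - p0) (p2 - p0) != 0 ->
  [\/ crossp (p0 - x) (p1 - x) != 0, crossp (p1 - x) (p2 - x) != 0 |
      crossp (p2 - x) (p0 - x) != 0].
Proof.
move=> h; have [h0|] := eqVneq (crossp (p0 - x) (p1 - x)) 0; last by constructor.
have [h1|] := eqVneq (crossp (p1 - x) (p2 - x)) 0; last by constructor.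
apply: Or33; apply: contra h => /eqP h2; apply/eqP.
transitivity (crossp (p0 - x) (p1 - x) + crossp (p1 - x) (p2 - x)
  + crossp (p2 - x) (p0 - x)); first by rewrite /crossp /=; ring.
by rewrite h0 h1 h2 !addr0.
Qed.

(** * From triples of joints to the whole framework *)

Section Forward.
Context (R : realType) (T : Type) (F : set_system T) {FU : UltraFilter F}.
Context (m n : nat) (p : 'I_m -> plane R) (q : 'I_n -> plane R).
Context (pt : T -> 'I_m -> plane R) (qt : T -> 'I_n -> plane R).
Hypothesis germ : flex_germ F p q pt qt.
Hypothesis fr : framework p q.

Lemma flex_germ_concentric3 (i0 i1 i2 : 'I_m) (j0 j1 j2 : 'I_n) :
  crossp (p i1 - p i0) (p i2 - p i0) != 0 ->
  crossp (q j1 - q j0) (q j2 - q j0) != 0 ->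
  concentric3 (p i0) (p i1) (p i2) (q j0) (q j1) (q j2).
Proof.
move=> pn qn; have [[cp cq] hd _ _] := germ.
have p01 : p i0 <> p i1.
  by move=> e; move: pn; rewrite e subrr /crossp /= !mul0r subrr eqxx.
have c0 : sqd (p i1) (p i0) != 0 by rewrite lt0r_neq0 //; apply: sqd_gt0 => /esym.
have mt : moving_triangle F (pt ^~ i0) (pt ^~ i1) (pt ^~ i2) (p i0) (p i1) (p i2).
  split; [exact: cp..|exact: (flex_germ_moving_pair germ p01 qn)|split=> //].
  by rewrite /sy mulf_neq0.
have mj j : moving_joint F (pt ^~ i0) (pt ^~ i1) (pt ^~ i2) (p i0) (p i1) (p i2)
    (qt ^~ j) (q j).
  split; first exact: cq.
    by apply: filterS hd => t d; rewrite !(sqdC (qt t j)) !d !(sqdC (q j)).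
  by split; apply: sqd_gt0 => /esym; exact: fr.
apply: (K33_concentric mt (q0 := qt ^~ j0) (q1 := qt ^~ j1) (q2 := qt ^~ j2)).
split=> //; rewrite (_ : det3 _ _ _ _ _ _ =
  4 * (sqd (p i1) (p i0) * crossp (q j1 - q j0) (q j2 - q j0))).
  by rewrite !mulf_neq0.
by rewrite /det3 /sx /sy /sqd /crossp /dotp /=; ring.
Qed.

(** Any further joint forms a non-collinear triple with two joints of the given triple. The pair of
    rectangles found for the new triple agrees with the old one, because the other part and a common
    vertex are shared. *)
Lemma flex_germ_concentric_rectangles (i0 i1 i2 : 'I_m) (j0 j1 j2 : 'I_n) :
  crossp (p i1 - p i0) (p i2 - p i0) != 0 ->
  crossp (q j1 - q j0) (q j2 - q j0) != 0 ->
  on_concentric_rectangles p q.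
Proof.
move=> pn qn.
have [ o [e1 [e2 [f [a [b [c [d [[a0 b0 c0 d0] hp hq]]]]]]]]] :=
  flex_germ_concentric3 pn qn.
exists o, e1, e2; split=> //; exists a, b, c, d; split=> //.
- have [hp0 hp1 hp2] := hp.
  have key i k l : crossp (p k - p i) (p l - p i) != 0 ->
      rect_vertices a b (coords o e1 e2 (p k)) ->
      rect_vertices a b (coords o e1 e2 (p i)).
    move=> n3 hk.
    have [ o' [e1' [e2' [f' [a' [b' [c' [d' [_ [hi' hk' _] hq']]]]]]]]] :=
      flex_germ_concentric3 n3 qn.
    exact: (rect_transfer c0 d0 f f' qn hq hq' hk hk' hi').
  move=> i; have [h|h|h] := crossp_triangle (p i) pn.
  + exact: key h hp0.
  + exact: key h hp1.
  + exact: key h hp2.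
- have [hq0 hq1 hq2] := hq.
  have key i k l : crossp (q k - q i) (q l - q i) != 0 ->
      rect_vertices c d (coords o e1 e2 (q k)) ->
      rect_vertices c d (coords o e1 e2 (q i)).
    move=> n3 hk.
    have [ o' [e1' [e2' [f' [a' [b' [c' [d' [_ hp' [hi' hk' _]]]]]]]]]] :=
      flex_germ_concentric3 pn n3.
    exact: (rect_transfer a0 b0 f f' pn hp hp' hk hk' hi').
  move=> i; have [h|h|h] := crossp_triangle (q i) qn.
  + exact: key h hq0.
  + exact: key h hq1.
  + exact: key h hq2.
Qed.

End Forward.

Lemma line_of_crossp0 (R : realType) (a u x : plane R) :
  u != 0 -> crossp u (x - a) = 0 -> line a u x.
Proof.
move=> u0 /(crossp0_scale u0) h; exists (dotp u (x - a) / dotp u u).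
by rewrite -[LHS](subrK a) [X in X + _]h addrC.
Qed.

Lemma three_ordinals (m : nat) : (3 <= m)%N -> exists i0 i1 i2 : 'I_m,
  [/\ i0 != i1, i2 != i0 & i2 != i1].
Proof.
move=> hm; exists (Ordinal (ltnW (ltnW hm))), (Ordinal (ltnW hm)), (Ordinal hm).
by split.
Qed.

Lemma flexible_lines_or_rectangles (R : realType) (m n : nat)
    (p : 'I_m -> plane R) (q : 'I_n -> plane R) :
  (3 <= m)%N -> (3 <= n)%N -> non_overlapping p q -> flexible p q ->
  on_orthogonal_lines p q \/ on_concentric_rectangles p q.
Proof.
move=> hm hn [ip iq fr] /(flex_germ_of_flex fr) [F [FU [pt [qt germ]]]].
have germ' : flex_germ F q p qt pt by exact: flex_germ_sym.
have [i0 [i1 [i2 [i01 i20 i21]]]] := three_ordinals hm.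
have [j0 [j1 [j2 [j01 j20 j21]]]] := three_ordinals hn.
have dp : [/\ p i0 <> p i1, p i2 <> p i0 & p i2 <> p i1].
  by split=> /ip /eqP; apply/negP.
have dq : [/\ q j0 <> q j1, q j2 <> q j0 & q j2 <> q j1].
  by split=> /iq /eqP; apply/negP.
have [cp|] := pselect (forall i, crossp (p i1 - p i0) (p i - p i0) = 0);
  have [cq|] := pselect (forall j, crossp (q j1 - q j0) (q j - q j0) = 0).
- left; have uv := flex_germ_two_lines germ dp dq cp cq.
  have u0 : p i1 - p i0 != 0 by rewrite subr_eq0; apply/eqP => /esym; case: dp.
  have v0 : q j1 - q j0 != 0 by rewrite subr_eq0; apply/eqP => /esym; case: dq.
  exists (p i0), (p i1 - p i0), (q j0), (q j1 - q j0); split.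
  + exact/eqP.
  + exact/eqP.
  + exact: uv.
  + by move=> i; exact: (line_of_crossp0 u0 (cp i)).
  + by move=> j; exact: (line_of_crossp0 v0 (cq j)).
- move=> /existsNP[j /eqP qn]; exfalso.
  exact: (flex_germ_line_noncollinear germ dp cp qn).
- move=> /existsNP[i /eqP pn]; exfalso.
  exact: (flex_germ_line_noncollinear germ' dq cq pn).
- move=> /existsNP[j /eqP qn] /existsNP[i /eqP pn]; right.
  exact: (flex_germ_concentric_rectangles germ fr pn qn).
Qed.

(** * Construction of flexes *)

Lemma flexible_sym (R : realType) (m n : nat)
    (p : 'I_m -> plane R) (q : 'I_n -> plane R) : flexible p q -> flexible q p.
Proof.
move=> [pt [qt [[cp cq] [s [t [sI tI st]]] [p0 q0] dist [i [j fx]]]]].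
have eC (x y : plane R) : eucl_dist x y = eucl_dist y x.
  by rewrite /eucl_dist -/(sqd x y) sqdC.
exists qt, pt; split=> //.
- by exists s, t; split=> //; case: st => h; [right|left].
- by move=> j' i' s' t' s'I t'I; rewrite eC (dist i' j' s' t') // eC.
- by exists j, i => t' t'I; have [] := fx t' t'I.
Qed.

Lemma cvg_plane (R : realType) (f g : R -> R) (x : R) :
  {for x, continuous f} -> {for x, continuous g} ->
  {for x, continuous (fun t => (f t, g t) : plane R)}.
Proof. by move=> cf cg; apply: (cvg_pair (F := nbhs x) cf cg). Qed.

(** Distances inside a part are invariant under the correcting isometries [mv t], so a change of one
    of them shows that the corrected motion is not constant. *)
Lemma flexible_of_motion (R : realType) (m n : nat)
    (p : 'I_m -> plane R) (q : 'I_n -> plane R) (i0 : 'I_m) (j0 : 'I_n)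
    (pt : R -> 'I_m -> plane R) (qt : R -> 'I_n -> plane R) :
  p i0 <> q j0 ->
  (forall i, continuous (pt ^~ i)) -> (forall j, continuous (qt ^~ j)) ->
  (forall i, pt 0 i = p i) -> (forall j, qt 0 j = q j) ->
  (forall t, t \in `[0, 1] -> forall i j,
     sqd (pt t i) (qt t j) = sqd (p i) (q j)) ->
  (exists i k, sqd (pt 1 i) (pt 1 k) <> sqd (p i) (p k)) \/
  (exists j l, sqd (qt 1 j) (qt 1 l) <> sqd (q j) (q l)) ->
  flexible p q.
Proof.
move=> pq cp cq p0 q0 dist nc.
pose z0 : plane R := q j0 - p i0; pose z t : plane R := qt t j0 - pt t i0.
pose r := dotp z0 z0.
have r0 : r != 0 by rewrite lt0r_neq0 //; apply: sqd_gt0 => /esym.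
(* Cosine and sine of the rotation taking [z t] back to [z0]; the two vectors have equal length
   because the rod keeps its length. *)
pose C t := dotp (z t) z0 / r; pose S t := crossp (z t) z0 / r.
pose mv t (x : plane R) : plane R :=
  ((p i0).1 + (C t * (x - pt t i0).1 - S t * (x - pt t i0).2),
   (p i0).2 + (S t * (x - pt t i0).1 + C t * (x - pt t i0).2)).
have z00 : z 0 = z0 by rewrite /z p0 q0.
have mv0 x : mv 0 x = x.
  rewrite /mv /C /S z00 -/r divff // p0.
  rewrite (_ : crossp z0 z0 = 0); last by rewrite /crossp; ring.
  rewrite mul0r [RHS]surjective_pairing /=; congr pair; ring.
have CS t : t \in `[0, 1] -> C t ^+ 2 + S t ^+ 2 = 1.
  move=> tI; have zr : dotp (z t) (z t) = r.
    by have := dist t tI i0 j0; rewrite sqdC [RHS]sqdC.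
  rewrite /C /S !expr_div_n -mulrDl.
  rewrite (_ : _ + _ = dotp (z t) (z t) * r); last by rewrite /r /dotp /crossp; ring.
  by rewrite zr -expr2 divff // sqrf_eq0.
have mvd t x y : t \in `[0, 1] -> sqd (mv t x) (mv t y) = sqd x y.
  move=> tI; transitivity ((C t ^+ 2 + S t ^+ 2) * sqd x y).
    by rewrite /sqd /dotp /mv /=; ring.
  by rewrite CS // mul1r.
have cz : continuous z by move=> t; apply: cvgB; [exact: cq|exact: cp].
have cC : continuous C.
  move=> t; apply: cvgM; last exact: cvg_cst.
  exact: (cvg_dotp (F := nbhs t) (cz t) (cvg_cst z0)).
have cS : continuous S.
  move=> t; apply: cvgM; last exact: cvg_cst.
  exact: (cvg_crossp (F := nbhs t) (cz t) (cvg_cst z0)).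
have cmv (x : R -> plane R) : continuous x -> continuous (fun t => mv t (x t)).
  move=> cx t; have cd : {for t, continuous (fun t => x t - pt t i0)}.
    by apply: cvgB; [exact: cx|exact: cp].
  have [c1 c2] := cvg_coord cd.
  have cCt : C @ t --> C t := cC t; have cSt : S @ t --> S t := cS t.
  apply: (cvg_plane (x := t)).
    exact: cvgD (cvg_cst (p i0).1) (cvgB (cvgM cCt c1) (cvgM cSt c2)).
  exact: cvgD (cvg_cst (p i0).2) (cvgD (cvgM cSt c1) (cvgM cCt c2)).
have I0 : (0 : R) \in `[0, 1] by rewrite in_itv /= lexx ler01.
have I1 : (1 : R) \in `[0, 1] by rewrite in_itv /= ler01 lexx.
exists (fun t i => mv t (pt t i)), (fun t j => mv t (qt t j)); split.
- by split=> i; apply: continuous_subspaceT; exact: cmv.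
- exists 0, 1; split=> //; apply: contrapT => /not_orP[/forallNP hp /forallNP hq].
  have {}hp i : mv 1 (pt 1 i) = p i.
    by apply: contrapT => h; apply: (hp i); rewrite mv0 p0 => /esym.
  have {}hq j : mv 1 (qt 1 j) = q j.
    by apply: contrapT => h; apply: (hq j); rewrite mv0 q0 => /esym.
  case: nc => -[i [k]]; apply; rewrite -(mvd 1 _ _ I1);
    by rewrite ?hp ?hq.
- by split=> i; rewrite mv0.
- move=> i j s t sI tI; congr Num.sqrt.
  by rewrite -/(sqd _ _) -/(sqd (mv t _) _) !mvd // !dist.
- exists i0, j0 => t tI; split.
    by rewrite /mv /= !subrr !mulr0 subrr addr0 addr0 addr0 -surjective_pairing.
  have zr : dotp (z t) (z t) = r.
    by have := dist t tI i0 j0; rewrite sqdC [RHS]sqdC.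
  rewrite /mv -/(z t) [RHS]surjective_pairing; congr pair.
    transitivity ((p i0).1 + dotp (z t) (z t) * z0.1 / r).
      by rewrite /C /S /dotp /crossp; ring.
    by rewrite zr mulrAC divff // mul1r /z0 /=; ring.
  transitivity ((p i0).2 + dotp (z t) (z t) * z0.2 / r).
    by rewrite /C /S /dotp /crossp; ring.
  by rewrite zr mulrAC divff // mul1r /z0 /=; ring.
Qed.

Lemma frame_decomposition (R : realType) (o e1 e2 x : plane R) :
  orthonormal_frame e1 e2 ->
  x = (o.1 + (dotp (x - o) e1 * e1.1 + dotp (x - o) e2 * e2.1),
       o.2 + (dotp (x - o) e1 * e1.2 + dotp (x - o) e2 * e2.2)).
Proof.
move=> fr; apply: sqd_eq0; have [h1 h2 h3] := fr; rewrite /sqd.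
set a := dotp (x - o) e1; set b := dotp (x - o) e2.
set y := (X in dotp X X); rewrite -(frame_parseval y fr).
have -> : dotp y e1 = 0.
  transitivity (a - (a * dotp e1 e1 + b * dotp e1 e2)).
    by rewrite /y /a /b /dotp /=; ring.
  by rewrite h1 h3; ring.
have -> : dotp y e2 = 0.
  transitivity (b - (a * dotp e1 e2 + b * dotp e2 e2)).
    by rewrite /y /a /b /dotp /=; ring.
  by rewrite h2 h3; ring.
by rewrite expr0n addr0.
Qed.

Lemma flexible_of_coords (R : realType) (m n : nat)
    (p : 'I_m -> plane R) (q : 'I_n -> plane R) (i0 : 'I_m) (j0 : 'I_n)
    (o e1 e2 : plane R) (X Y : R -> 'I_m -> R) (U V : R -> 'I_n -> R) :
  orthonormal_frame e1 e2 -> p i0 <> q j0 ->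
  (forall i, continuous (X ^~ i)) -> (forall i, continuous (Y ^~ i)) ->
  (forall j, continuous (U ^~ j)) -> (forall j, continuous (V ^~ j)) ->
  (forall i, coords o e1 e2 (p i) = (X 0 i, Y 0 i)) ->
  (forall j, coords o e1 e2 (q j) = (U 0 j, V 0 j)) ->
  (forall t, t \in `[0, 1] -> forall i j,
     (X t i - U t j) ^+ 2 + (Y t i - V t j) ^+ 2 =
     (X 0 i - U 0 j) ^+ 2 + (Y 0 i - V 0 j) ^+ 2) ->
  (exists i k, (X 1 i - X 1 k) ^+ 2 + (Y 1 i - Y 1 k) ^+ 2 <>
     (X 0 i - X 0 k) ^+ 2 + (Y 0 i - Y 0 k) ^+ 2) \/
  (exists j l, (U 1 j - U 1 l) ^+ 2 + (V 1 j - V 1 l) ^+ 2 <>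
     (U 0 j - U 0 l) ^+ 2 + (V 0 j - V 0 l) ^+ 2) ->
  flexible p q.
Proof.
move=> fr pq cX cY cU cV hp hq dist nc.
pose P (a b : R) : plane R :=
  (o.1 + (a * e1.1 + b * e2.1), o.2 + (a * e1.2 + b * e2.2)).
have Pd a b c d : sqd (P a b) (P c d) = (a - c) ^+ 2 + (b - d) ^+ 2.
  have [h1 h2 h3] := fr.
  transitivity ((a - c) ^+ 2 * dotp e1 e1 + (b - d) ^+ 2 * dotp e2 e2
     + 2 * (a - c) * (b - d) * dotp e1 e2).
    by rewrite /sqd /dotp /P /=; ring.
  by rewrite h1 h2 h3; ring.
have Pc (f g : R -> R) : continuous f -> continuous g ->
    continuous (fun t => P (f t) (g t)).
  move=> cf cg t; have cft : f @ t --> f t := cf t; have cgt : g @ t --> g t := cg t.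
  apply: (cvg_plane (x := t)).
    exact: cvgD (cvg_cst o.1) (cvgD (cvgM cft (cvg_cst e1.1)) (cvgM cgt (cvg_cst e2.1))).
  exact: cvgD (cvg_cst o.2) (cvgD (cvgM cft (cvg_cst e1.2)) (cvgM cgt (cvg_cst e2.2))).
have p0 i : P (X 0 i) (Y 0 i) = p i.
  have [h1 h2] := hp i; rewrite -h1 -h2; exact/esym/frame_decomposition.
have q0 j : P (U 0 j) (V 0 j) = q j.
  have [h1 h2] := hq j; rewrite -h1 -h2; exact/esym/frame_decomposition.
apply: (@flexible_of_motion _ _ _ _ _ i0 j0 (fun t i => P (X t i) (Y t i))
  (fun t j => P (U t j) (V t j))) => //.
- by move=> i; exact: Pc.
- by move=> j; exact: Pc.
- by move=> t tI i j; rewrite -p0 -q0 !Pd dist.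
- by case: nc => -[i [k h]]; [left|right]; exists i, k; rewrite -?p0 -?q0 !Pd.
Qed.

(** The value at 0 is 1, so the square is always 1 and a joint starting at the origin moves as
    well. *)
Definition sign (R : realType) (x : R) : R := if 0 <= x then 1 else -1.

Lemma sign_sqr (R : realType) (x : R) : sign x ^+ 2 = 1.
Proof. by rewrite /sign; case: ifP => _; ring. Qed.

Lemma sign_sqrt (R : realType) (x : R) : sign x * Num.sqrt (x ^+ 2) = x.
Proof.
rewrite sqrtr_sqr /sign; case: (lerP 0 x) => h; first by rewrite mul1r ger0_norm.
by rewrite mulN1r ltr0_norm // opprK.
Qed.

Definition root_path (R : realType) (x k t : R) : R :=
  sign x * Num.sqrt (x ^+ 2 + k * t).

Lemma root_path0 (R : realType) (x k : R) : root_path x k 0 = x.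
Proof. by rewrite /root_path mulr0 addr0 sign_sqrt. Qed.

Lemma root_path_sqr (R : realType) (x k t : R) :
  0 <= x ^+ 2 + k * t -> root_path x k t ^+ 2 = x ^+ 2 + k * t.
Proof. by move=> h; rewrite /root_path exprMn sign_sqr mul1r sqr_sqrtr. Qed.

(** [Num.sqrt] is 0 on negative numbers and continuous everywhere, so no bound on [t] is
    required. *)
Lemma root_path_continuous (R : realType) (x k : R) : continuous (root_path x k).
Proof.
move=> t; apply: cvgM; first exact: cvg_cst.
apply: (@continuous_comp _ _ _ (fun t => x ^+ 2 + k * t) Num.sqrt).
  apply: cvgD; first exact: cvg_cst.
  by apply: cvgM; [exact: cvg_cst|exact: cvg_id].
exact: sqrt_continuous.
Qed.

(** Small positive numbers lie below each of finitely many positive bounds; this also covers an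
    empty family, which has no minimum. *)
Lemma finite_positive_lower_bound (R : realType) (n : nat) (f : 'I_n -> R) :
  (forall j, 0 < f j) -> exists2 k : R, 0 < k & forall j, k <= f j.
Proof.
move=> f0.
have h : \forall k \near (0 : R)^'+, forall j, k <= f j.
  by apply: filter_forall => j; exact: nbhs_right_le.
have [k [k0 hk]] := filter_ex (filterI (nbhs_right_gt (0 : R)) h).
by exists k.
Qed.

(** Squared rods are sums of a squared abscissa and a squared ordinate, and the changes [k * t]
    cancel. As no q_j is at the origin, a positive [k] below all squared ordinates exists. *)
Lemma flexible_axes (R : realType) (m n : nat)
    (p : 'I_m -> plane R) (q : 'I_n -> plane R) (i0 i1 : 'I_m) (j0 : 'I_n)
    (o e1 e2 : plane R) :
  orthonormal_frame e1 e2 -> p i0 <> q j0 -> p i0 <> p i1 ->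
  (forall i, dotp (p i - o) e2 = 0) ->
  (forall j, dotp (q j - o) e1 = 0 /\ dotp (q j - o) e2 != 0) ->
  flexible p q.
Proof.
move=> fr pq p01 hp hq.
pose x i := dotp (p i - o) e1; pose y j := dotp (q j - o) e2.
have [k k0 hk] : exists2 k : R, 0 < k & forall j, k <= y j ^+ 2.
  by apply: finite_positive_lower_bound => j; rewrite exprn_even_gt0 //; have [] := hq j.
have hx t i : 0 <= t -> root_path (x i) k t ^+ 2 = x i ^+ 2 + k * t.
  by move=> t0; rewrite root_path_sqr // addr_ge0 ?sqr_ge0 // mulr_ge0 // ltW.
have hy t j : t <= 1 -> root_path (y j) (- k) t ^+ 2 = y j ^+ 2 - k * t.
  move=> t1; rewrite root_path_sqr mulNr // subr_ge0.
  by apply: le_trans (hk j); rewrite ler_piMr // ltW.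
apply: (@flexible_of_coords _ _ _ p q i0 j0 o e1 e2
  (fun t i => root_path (x i) k t) (fun _ _ => 0) (fun _ _ => 0)
  (fun t j => root_path (y j) (- k) t)) => //.
- by move=> i; exact: root_path_continuous.
- by move=> i t; exact: cvg_cst.
- by move=> j t; exact: cvg_cst.
- by move=> j; exact: root_path_continuous.
- by move=> i; rewrite root_path0 /coords hp.
- by move=> j; rewrite root_path0 /coords (hq j).1.
- move=> t; rewrite in_itv /= => /andP[t0 t1] i j.
  by rewrite !subr0 !sub0r !sqrrN hx // hy // !root_path0; ring.
- left; exists i0, i1; rewrite !subrr expr0n /= !addr0 !root_path0 => h.
  have x01 : x i0 != x i1.
    apply/eqP => e; apply: p01.
    by rewrite (frame_decomposition o (p i0) fr) (frame_decomposition o (p i1) fr) !hp -/(x i0) e.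
  have h0 := hx 1 i0 ler01; have h1 := hx 1 i1 ler01; rewrite mulr1 in h0 h1.
  set a := root_path (x i0) k 1 in h h0; set b := root_path (x i1) k 1 in h h1.
  (* If the distance were unchanged, the product of the new abscissae would be known, and comparing
     its square with the product of their squares would give [k * (x i0 - x i1) ^+ 2 = 0]. *)
  have ab : a * b = k + x i0 * x i1 by lra.
  have : k * (x i0 - x i1) ^+ 2 = 0.
    transitivity ((x i0 ^+ 2 + k) * (x i1 ^+ 2 + k) - (k + x i0 * x i1) ^+ 2); first by ring.
    by rewrite -h0 -h1 -ab; ring.
  by move/eqP; rewrite mulf_eq0 sqrf_eq0 subr_eq0 (negPf x01) orbF gt_eqF.
Qed.

Lemma frame_swap (R : realType) (e1 e2 : plane R) :
  orthonormal_frame e1 e2 -> orthonormal_frame e2 e1.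
Proof. by move=> [h1 h2 h3]; split=> //; rewrite -h3 /dotp; ring. Qed.

Lemma flexible_on_orthogonal_lines (R : realType) (m n : nat)
    (p : 'I_m -> plane R) (q : 'I_n -> plane R) (i0 i1 : 'I_m) (j0 j1 : 'I_n) :
  non_overlapping p q -> i0 != i1 -> j0 != j1 ->
  on_orthogonal_lines p q -> flexible p q.
Proof.
move=> [ip iq pq] i01 j01 [a [u [b [v [u0 v0 uv hp hq]]]]].
have p01 : p i0 <> p i1 by move=> /ip /eqP; apply/negP.
have q01 : q j0 <> q j1 by move=> /iq /eqP; apply/negP.
have un : u != 0 by exact/eqP.
pose r := Num.sqrt (dotp u u).
have r0 : r != 0 by rewrite gt_eqF // sqrtr_gt0 dotpp_gt0.
have r2 : r ^+ 2 = dotp u u by rewrite sqr_sqrtr // ltW // dotpp_gt0.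
pose e1 : plane R := (u.1 / r, u.2 / r); pose e2 : plane R := (- u.2 / r, u.1 / r).
have fr : orthonormal_frame e1 e2.
  split.
  - rewrite (_ : dotp e1 e1 = dotp u u / r ^+ 2); last by rewrite /dotp /=; field.
    by rewrite r2 divff // lt0r_neq0 // dotpp_gt0.
  - rewrite (_ : dotp e2 e2 = dotp u u / r ^+ 2); last by rewrite /dotp /=; field.
    by rewrite r2 divff // lt0r_neq0 // dotpp_gt0.
  - by rewrite /dotp /=; ring.
(* [o] is the intersection of the two lines. *)
pose w := dotp (b - a) e1; pose o : plane R := (a.1 + w * e1.1, a.2 + w * e1.2).
have [h1 h2 h3] := fr.
have pe i : dotp (p i - o) e2 = 0.
  have [s ->] := hp i; transitivity (- w * dotp e1 e2); last by rewrite h3 mulr0.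
  by rewrite /o /dotp /=; ring.
have qe j : dotp (q j - o) e1 = 0.
  have [s ->] := hq j; transitivity (w + s * dotp u v / r - w * dotp e1 e1).
    by rewrite {1}/w /o /dotp /=; ring.
  by rewrite h1 uv; ring.
have [hn|] := pselect (forall j, dotp (q j - o) e2 != 0).
  exact: (flexible_axes (i0 := i0) (i1 := i1) (j0 := j0) (o := o) fr).
(* If some q_j sits at [o], no p_i does, since the joints are distinct; the two parts exchange
   roles. *)
move=> /existsNP[j /negP]; rewrite negbK => /eqP qj0.
have qjo : q j = o.
  by rewrite (frame_decomposition o (q j) fr) qe qj0 !mul0r !addr0 -surjective_pairing.
apply: flexible_sym.
apply: (flexible_axes (i0 := j0) (i1 := j1) (j0 := i0) (o := o) (frame_swap fr)) => //.
  by move=> /esym; exact: pq.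
move=> i; split=> //; apply/eqP => pi0; apply: (pq i j).
by rewrite qjo (frame_decomposition o (p i) fr) pe pi0 !mul0r !addr0 -surjective_pairing.
Qed.

(* [a] and [c] are recovered from [a + c] and [a - c]; moving along
   [root_path] keeps their product and adds [k * t] to [a^2 + c^2]. *)
Definition half_sum (R : realType) (a c k t : R) : R :=
  (root_path (a + c) k t + root_path (a - c) k t) / 2.
Definition half_diff (R : realType) (a c k t : R) : R :=
  (root_path (a + c) k t - root_path (a - c) k t) / 2.

Lemma half_sum0 (R : realType) (a c k : R) : half_sum a c k 0 = a.
Proof. by rewrite /half_sum !root_path0; field. Qed.

Lemma half_diff0 (R : realType) (a c k : R) : half_diff a c k 0 = c.
Proof. by rewrite /half_diff !root_path0; field. Qed.

Lemma half_sum_diff (R : realType) (a c k t : R) :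
  0 <= (a + c) ^+ 2 + k * t -> 0 <= (a - c) ^+ 2 + k * t ->
  half_sum a c k t * half_diff a c k t = a * c /\
  half_sum a c k t ^+ 2 + half_diff a c k t ^+ 2 = a ^+ 2 + c ^+ 2 + k * t.
Proof.
move=> h1 h2; split.
  transitivity ((root_path (a + c) k t ^+ 2 - root_path (a - c) k t ^+ 2) / 4).
    by rewrite /half_sum /half_diff; field.
  by rewrite !root_path_sqr //; field.
transitivity ((root_path (a + c) k t ^+ 2 + root_path (a - c) k t ^+ 2) / 2).
  by rewrite /half_sum /half_diff; field.
by rewrite !root_path_sqr //; field.
Qed.

Lemma half_sum_continuous (R : realType) (a c k : R) : continuous (half_sum a c k).
Proof.
move=> t; apply: cvgM; last exact: cvg_cst.
by apply: cvgD; exact: root_path_continuous.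
Qed.

Lemma half_diff_continuous (R : realType) (a c k : R) : continuous (half_diff a c k).
Proof.
move=> t; apply: cvgM; last exact: cvg_cst.
by apply: cvgB; exact: root_path_continuous.
Qed.

Lemma rect_vertices_side (R : realType) (m : nat) (x y : 'I_m -> R) (a b : R)
    (i0 i1 i2 : 'I_m) :
  i0 != i1 -> i2 != i0 -> i2 != i1 ->
  (forall i, rect_vertices a b (x i, y i)) ->
  (forall i k, i != k -> (x i, y i) <> (x k, y k)) ->
  exists i k, x i = - x k /\ y i = y k.
Proof.
move=> i01 i20 i21 h inj.
have key i k : i != k -> y i = y k -> exists i k, x i = - x k /\ y i = y k.
  move=> ik yik; exists i, k; split=> //.
  have [/rect_verticesE[/= xi _] /rect_verticesE[/= xk _]] := (h i, h k).
  have /eqP := etrans xi (esym xk); rewrite eqf_sqr => /orP[] /eqP // xik.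
  by case: (inj i k ik); rewrite xik yik.
have [_ /= y0] := h i0; have [_ /= y1] := h i1; have [_ /= y2] := h i2.
by case: y0 => y0; case: y1 => y1; case: y2 => y2;
  solve [apply: (key i0 i1) => //; rewrite y0 y1 //
        |apply: (key i2 i0) => //; rewrite y0 y2 //
        |apply: (key i2 i1) => //; rewrite y1 y2 //].
Qed.

(** A squared rod depends only on [A * C], [B * D] and the sum of the four squares, and all three
    are constant along the motion. *)
Lemma flexible_rectangles (R : realType) (m n : nat)
    (p : 'I_m -> plane R) (q : 'I_n -> plane R) (i0 i1 i2 : 'I_m) (j0 j1 j2 : 'I_n)
    (o e1 e2 : plane R) (a b c d : R) :
  orthonormal_frame e1 e2 -> non_overlapping p q ->
  [/\ i0 != i1, i2 != i0 & i2 != i1] -> [/\ j0 != j1, j2 != j0 & j2 != j1] ->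
  [/\ 0 < a, 0 < b, 0 < c & 0 < d] -> b != d ->
  (forall i, rect_vertices a b (coords o e1 e2 (p i))) ->
  (forall j, rect_vertices c d (coords o e1 e2 (q j))) -> flexible p q.
Proof.
move=> fr [ip iq pq] [i01 i20 i21] [j01 j20 j21] [a0 b0 c0 d0] bd hp hq.
have cinj (x y : plane R) : coords o e1 e2 x = coords o e1 e2 y -> x = y.
  move=> [h1 h2].
  by rewrite (frame_decomposition o x fr) (frame_decomposition o y fr) h1 h2.
pose x i := dotp (p i - o) e1; pose y i := dotp (p i - o) e2.
pose u j := dotp (q j - o) e1; pose v j := dotp (q j - o) e2.
(* The largest rate at which the square of [b - d] stays nonnegative up to time 1; it is positive
   because [b] and [d] differ. *)
pose k := (b - d) ^+ 2.
have k0 : 0 < k by rewrite exprn_even_gt0 //= subr_eq0.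
pose A := half_sum a c k; pose C := half_diff a c k.
pose B := half_sum b d (- k); pose D := half_diff b d (- k).
have AC t : 0 <= t -> A t * C t = a * c /\ A t ^+ 2 + C t ^+ 2 = a ^+ 2 + c ^+ 2 + k * t.
  by move=> t0; apply: half_sum_diff; rewrite addr_ge0 ?sqr_ge0 // mulr_ge0 // ltW.
have BD t : 0 <= t <= 1 ->
    B t * D t = b * d /\ B t ^+ 2 + D t ^+ 2 = b ^+ 2 + d ^+ 2 - k * t.
  move=> /andP[t0 t1]; have kt : k * t <= k by rewrite ler_piMr // ltW.
  rewrite -mulNr; apply: half_sum_diff; rewrite mulNr subr_ge0 //.
  apply: le_trans kt _; rewrite -subr_ge0 /k.
  rewrite (_ : _ - _ = 4 * (b * d)); last ring.
  by rewrite !mulr_ge0 // ltW.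
have sg (z r : R) : 0 < r -> z = r \/ z = - r -> (z / r) ^+ 2 = 1.
  move=> r0 h; have rn : r != 0 by rewrite gt_eqF.
  by rewrite expr_div_n; case: h => ->; rewrite ?sqrrN divff // sqrf_eq0.
have xs i : (x i / a) ^+ 2 = 1 by apply: sg => //; have [] := hp i.
have ys i : (y i / b) ^+ 2 = 1 by apply: sg => //; have [] := hp i.
have us j : (u j / c) ^+ 2 = 1 by apply: sg => //; have [] := hq j.
have vs j : (v j / d) ^+ 2 = 1 by apply: sg => //; have [] := hq j.
have bil (e f X Y XY : R) : e ^+ 2 = 1 -> f ^+ 2 = 1 -> X * Y = XY ->
    (e * X - f * Y) ^+ 2 = X ^+ 2 + Y ^+ 2 - 2 * e * f * XY.
  move=> he hf <-; transitivity (e ^+ 2 * X ^+ 2 + f ^+ 2 * Y ^+ 2 - 2 * e * f * (X * Y)).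
    by ring.
  by rewrite he hf; ring.
have A0 : A 0 = a by exact: half_sum0.
have C0 : C 0 = c by exact: half_diff0.
have B0 : B 0 = b by exact: half_sum0.
have D0 : D 0 = d by exact: half_diff0.
have cz (z : R) (f : R -> R) : continuous f -> continuous (fun t => z * f t).
  by move=> cf t; have cft : f @ t --> f t := cf t; exact: cvgM (cvg_cst z) cft.
have cA : continuous A by exact: half_sum_continuous.
have cB : continuous B by exact: half_sum_continuous.
have cC : continuous C by exact: half_diff_continuous.
have cD : continuous D by exact: half_diff_continuous.
apply: (@flexible_of_coords _ _ _ p q i0 j0 o e1 e2
  (fun t i => x i / a * A t) (fun t i => y i / b * B t)
  (fun t j => u j / c * C t) (fun t j => v j / d * D t)) => //.
- by move=> i; exact: cz.
- by move=> i; exact: cz.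
- by move=> j; exact: cz.
- by move=> j; exact: cz.
- by move=> i; rewrite A0 B0 !divfK // gt_eqF.
- by move=> j; rewrite C0 D0 !divfK // gt_eqF.
- move=> t; rewrite in_itv /= => t01 i j; have /andP[t0 _] := t01.
  have [ac ac2] := AC t t0; have [bd1 bd2] := BD t t01.
  rewrite !(bil _ _ _ _ _ (xs i) (us j) ac) !(bil _ _ _ _ _ (ys i) (vs j) bd1).
  rewrite (bil _ _ _ _ (a * c) (xs i) (us j)) ?A0 ?C0 //.
  rewrite (bil _ _ _ _ (b * d) (ys i) (vs j)) ?B0 ?D0 //.
  have -> : C t ^+ 2 = a ^+ 2 + c ^+ 2 + k * t - A t ^+ 2 by rewrite -ac2; ring.
  have -> : D t ^+ 2 = b ^+ 2 + d ^+ 2 - k * t - B t ^+ 2 by rewrite -bd2; ring.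
  by ring.
(* Two joints of a part with equal ordinates and opposite abscissae are at distance 2 [A],
   respectively 2 [C], so a change of [A] or [C] is visible inside a part. Both cannot stay the
   same, as the sum of their squares grows by [k]. *)
have [i [i' [xi yi]]] : exists i k, x i = - x k /\ y i = y k.
  apply: (rect_vertices_side i01 i20 i21 hp) => i k' ik /cinj /ip /eqP.
  by apply/negP.
have [j [j' [uj vj]]] : exists j k, u j = - u k /\ v j = v k.
  apply: (rect_vertices_side j01 j20 j21 hq) => j k' jk /cinj /iq /eqP.
  by apply/negP.
have [e1' e2'] := AC 1 ler01; rewrite mulr1 in e2'.
have opp (e X Y Z W : R) : e ^+ 2 = 1 ->
    (- e * X - e * X) ^+ 2 + (Z - Z) ^+ 2 = (- e * Y - e * Y) ^+ 2 + (W - W) ^+ 2 ->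
    X ^+ 2 = Y ^+ 2.
  move=> he; rewrite !subrr expr0n /= !addr0 => h.
  apply: (@mulfI _ 4); rewrite ?pnatr_eq0 //; move: h.
  rewrite (_ : (- e * X - e * X) ^+ 2 = e ^+ 2 * (4 * X ^+ 2)); last ring.
  rewrite (_ : (- e * Y - e * Y) ^+ 2 = e ^+ 2 * (4 * Y ^+ 2)); last ring.
  by rewrite he !mul1r.
have [Aa|Aa] := eqVneq (A 1 ^+ 2) (a ^+ 2); last first.
  left; exists i, i'; rewrite xi yi A0 mulNr => h.
  by move/eqP: Aa; apply; exact: opp (xs i') h.
right; exists j, j'; rewrite uj vj C0 mulNr => h.
have Cc : C 1 ^+ 2 = c ^+ 2 by exact: opp (us j') h.
by move: k0; rewrite (_ : k = 0) ?ltxx //; rewrite Aa Cc in e2'; lra.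
Qed.

Lemma flexible_on_concentric_rectangles (R : realType) (m n : nat)
    (p : 'I_m -> plane R) (q : 'I_n -> plane R) :
  (3 <= m)%N -> (3 <= n)%N -> non_overlapping p q ->
  on_concentric_rectangles p q -> flexible p q.
Proof.
move=> hm hn no [ o [e1 [e2 [fr [a [b [c [d [pos hp hq]]]]]]]]].
have [i0 [i1 [i2 hi]]] := three_ordinals hm.
have [j0 [j1 [j2 hj]]] := three_ordinals hn.
have [bd|bd] := eqVneq b d; last exact: (flexible_rectangles fr no hi hj pos bd hp hq).
have [ac|ac] := eqVneq a c; last first.
  have pos' : [/\ 0 < b, 0 < a, 0 < d & 0 < c] by case: pos.
  apply: (flexible_rectangles (o := o) (frame_swap fr) no hi hj pos' ac) => i.
    by have [h1 h2] := hp i; split.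
  by have [h1 h2] := hq i; split.
(* The two rectangles coincide, so at least six distinct joints would share four vertices; [f] names
   a vertex by two booleans. *)
exfalso; subst d c; have [ip iq pq] := no.
pose f (x : plane R) : bool * bool := (dotp (x - o) e1 == a, dotp (x - o) e2 == b).
have f_inj x y : rect_vertices a b (coords o e1 e2 x) ->
    rect_vertices a b (coords o e1 e2 y) -> f x = f y -> x = y.
  move=> [/= x1 x2] [/= y1 y2] [h1 h2].
  rewrite (frame_decomposition o x fr) (frame_decomposition o y fr).
  have key (s t r : R) : (s = r \/ s = - r) -> (t = r \/ t = - r) ->
      (s == r) = (t == r) -> s = t.
    move=> [->|->] [->|->] //; rewrite eqxx; last by move/eqP.
    by move=> h; apply/esym/eqP; rewrite -h.
  by rewrite (key _ _ _ x1 y1 h1) (key _ _ _ x2 y2 h2).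
pose g (k : 'I_m + 'I_n) := match k with inl i => f (p i) | inr j => f (q j) end.
have g_inj : injective g.
  move=> [i|j] [i'|j'] /=.
  - by move=> /(f_inj _ _ (hp _) (hp _)) /ip ->.
  - by move=> /(f_inj _ _ (hp _) (hq _)) /pq.
  - by move=> /(f_inj _ _ (hq _) (hp _)) /esym /pq.
  - by move=> /(f_inj _ _ (hq _) (hq _)) /iq ->.
have := leq_card g g_inj; rewrite card_sum card_prod card_bool !card_ord.
by move=> h; have := leq_trans (leq_add hm hn) h.
Qed.

Theorem theorem1 (R : realType) (m n : nat) (hmn : (3 <= minn m n)%N)
    (p : 'I_m -> plane R) (q : 'I_n -> plane R)
    (hpq : framework p q) (hno : non_overlapping p q) :
  flexible p q <->
  on_orthogonal_lines p q \/ on_concentric_rectangles p q.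
Proof.
move: hmn; rewrite leq_min => /andP[hm hn]; split.
  exact: flexible_lines_or_rectangles.
case; last exact: flexible_on_concentric_rectangles.
have [i0 [i1 [_ [i01 _ _]]]] := three_ordinals hm.
have [j0 [j1 [_ [j01 _ _]]]] := three_ordinals hn.
exact: (flexible_on_orthogonal_lines hno i01 j01).
Qed.
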